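(* Let $V$ be a vertex operator algebra, $W$ an ordinary $V$-module of conformal weight $0$, $U=V\rtimes W'$ the semidirect product vertex operator algebra, and $T\in\mathrm{Hom}_{\mathrm{LP}}(W,V)$ a level-preserving linear map. For each $t\ge0$ let $\{v_1^t,\dots,v_{p_t}^t\}$ be a basis of $W(t)$ and $\{(v_1^t)^*,\dots,(v_{p_t}^t)^*\}$ the dual basis of $W(t)^*$, and let $$r=T-\sigma(T)=\sum_{t=0}^\infty\sum_{i=1}^{p_t}\big(T(v_i^t)\otimes(v_i^t)^*-(v_i^t)^*\otimes T(v_i^t)\big)\in\mathrm{SD}(U\widehat\otimes U).$$ Let $m\in\mathbb Z$. Then $r$ satisfies the $m$-VOYBE $$r_{12}\cdot_m r_{13}-r_{23}\cdot'_m r_{12}+r_{13}\cdot'^{\mathrm{op}}_m r_{23}=0$$ in $U=V\rtimes W'$ if and only if $T:W\to V$ is an $m$-strong relative Rota-Baxter operator. In particular, $r$ is a solution to the VOYBE in $U$ if and only if $T:W\to V$ is a strong relative Rota-Baxter operator.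
   Context: The base field is $\mathbb C$, $\mathbb N=\{0,1,2,\dots\}$. A vertex operator algebra (VOA) is understood in the usual sense and is $\mathbb N$-graded, $V=\bigoplus_{n\ge0}V_n$, $\dim V_n<\infty$, with $V_n$ the eigenspace of $L(0)$ of eigenvalue $n$; $Y_V(a,z)=\sum_m a_mz^{-m-1}$, $Y_V(\omega,z)=\sum_nL(n)z^{-n-2}$. An ordinary $V$-module of conformal weight $0$ is a $V$-module $(W,Y_W)$ (truncation, vacuum property, Jacobi identity) with $W=\bigoplus_{n\ge0}W(n)$, $\dim W(n)<\infty$, $L(0)=n$ on $W(n)$. Its contragredient module is $W'=\bigoplus_nW(n)^*$ with $\langle Y_{W'}(a,z)f,u\rangle=\langle f,Y_W(e^{zL(1)}(-z^{-2})^{L(0)}a,z^{-1})u\rangle$; $V'$, $Y_{V'}$ are defined in the same way from the adjoint module $V$. $T\in\mathrm{Hom}_{\mathrm{LP}}(W,V)$ means $T(W(n))\subseteq V_n$ for all $n$. Operators (for $a\in V$, $u\in W$, $u^*\in W'$, $f\in V'$): $Y_{WV}^W(u,z)a=e^{zL(-1)}Y_W(a,-z)u$; $Y_{W'V}^{W'}(u^*,z)a=e^{zL(-1)}Y_{W'}(a,-z)u^*$; $Y_{V'V}^{V'}(f,z)a=e^{zL(-1)}Y_{V'}(a,-z)f$; $\langle\mathcal Y_{WW'}^{V'}(u,z)u^*,a\rangle=\langle u^*,Y_{WV}^W(e^{zL(1)}(-z^{-2})^{L(0)}u,z^{-1})a\rangle$; $\mathcal Y_{W'W}^{V'}(u^*,z)u=e^{zL(-1)}\mathcal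 Y_{WW'}^{V'}(u,-z)u^*$. Write $a_mu=\mathrm{Res}_zz^mY_W(a,z)u$, $u(m)a=\mathrm{Res}_zz^mY_{WV}^W(u,z)a$. The map $T^*:V'\to W'$ is $\langle T^*(f),u\rangle=\langle f,T(u)\rangle$. $T$ is an $m$-relative Rota-Baxter operator if $T(u)_mT(v)=T(T(u)_mv)+T(u(m)T(v))$ for all $u,v\in W$. A level-preserving $T$ is an $m$-strong relative Rota-Baxter operator if it is an $m$-relative Rota-Baxter operator and for all $u\in W$, $f\in V'$: (a) $\mathrm{Res}_zz^m\big(Y_{W'}(T(u),z)T^*(f)-T^*(Y_{V'}(T(u),z)f)+T^*(\mathcal Y_{WW'}^{V'}(u,z)T^*(f))\big)=0$; (b) $\mathrm{Res}_zz^m\big(Y_{W'V}^{W'}(T^*(f),z)T(u)-T^*(Y_{V'V}^{V'}(f,z)T(u))+T^*(\mathcal Y_{W'W}^{V'}(T^*(f),z)u)\big)=0$. $T$ is strong if it is $m$-strong for all $m\in\mathbb Z$. Semidirect product: $U=V\rtimes W'=V\oplus W'$, $U(n)=V_n\oplus W(n)^*$, $Y_U(a+f,z)(b+g)=Y_V(a,z)b+\big(Y_{W'}(a,z)g+Y_{W'V}^{W'}(f,z)b\big)$ for $a,b\in V$, $f,g\in W'$; with $\mathbf 1,\omega\in V$ this is a VOA. $m$-dot products: for $\alpha,\beta\in U$, $\alpha\cdot_m\beta=\beta_m\alpha$; $\alpha\cdot'_m\beta=\mathrm{Res}_zz^mY_U(e^{zL(1)}(-z^{-2})^{L(0)}\alpha,z^{-1})\beta$;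 $\alpha\cdot'^{\mathrm{op}}_m\beta=\mathrm{Res}_zz^mY_U(e^{-zL(1)}(-z^{-2})^{L(0)}\beta,-z^{-1})e^{zL(1)}\alpha$. $U\widehat\otimes U=\prod_{p,q\ge0}U(p)\otimes U(q)$, $U^{\widehat\otimes3}=\prod_{p,q,s}U(p)\otimes U(q)\otimes U(s)$; $\sigma$ is the flip; $\mathrm{SD}(U\widehat\otimes U)$ is the set of $r\in\prod_tU(t)\otimes U(t)$ with $\sigma(r)=-r$. A level-preserving $T$ is identified with $\sum_t\sum_iT(v_i^t)\otimes(v_i^t)^*\in\prod_tV_t\otimes W(t)^*\subset\prod_t U(t)\otimes U(t)$. For $r=\sum_tr^t$ with $r^t=\sum_ix_i^t\otimes y_i^t\in U(t)\otimes U(t)$ (finite sum for each $t$), put $r_{12}\cdot_mr_{13}=\sum_{t,s}\sum_{i,k}(x_i^t\cdot_mx_k^s)\otimes y_i^t\otimes y_k^s$, $r_{23}\cdot'_mr_{12}=\sum_{q,t}\sum_{l,i}x_i^t\otimes(x_l^q\cdot'_my_i^t)\otimes y_l^q$, $r_{13}\cdot'^{\mathrm{op}}_mr_{23}=\sum_{s,q}\sum_{k,l}x_k^s\otimes x_l^q\otimes(y_k^s\cdot'^{\mathrm{op}}_my_l^q)$, well-defined elements of $U^{\widehat\otimes3}$. A solution to the VOYBE is an $r\in\mathrm{SD}(U\widehat\otimes U)$ solving the $m$-VOYBE for every $m\in\mathbb Z$. *)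

(* Defs.v *)
From HB Require Import structures.
From mathcomp Require Import all_boot all_order all_algebra.
From mathcomp Require Import complex zify ring.
From mathcomp Require Import boolp classical_sets functions cardinality fsbigop.
From mathcomp Require Import reals.

Set Implicit Arguments.
Unset Strict Implicit.
Unset Printing Implicit Defensive.

Import Order.TTheory GRing.Theory Num.Theory.
Local Open Scope classical_set_scope.
Local Open Scope ring_scope.

(* [dsum G] is the external direct sum of the spaces [G n], n >= 0. *)
Record dsum (K : fieldType) (G : nat -> vectType K) : Type := Dsum {
  dcoef :> forall n, G n;
  dsum_fin : exists N, forall n, (N <= n)%N -> dcoef n = 0 }.

HB.instance Definition _ (K : fieldType) (G : nat -> vectType K) :=
  gen_eqMixin (dsum G).
HB.instance Definition _ (K : fieldType) (G : nat -> vectType K) :=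
  gen_choiceMixin (dsum G).

Section DirectSum.
Variables (K : fieldType) (G : nat -> vectType K).
Implicit Types x y z : dsum G.

Lemma dsumP x y : (forall n, x n = y n) -> x = y.
Proof.
case: x y => [f hf] [g hg] /= e.
have E : f = g by apply: functional_extensionality_dep.
by case: g / E hg {e} => hg; congr Dsum; apply: Prop_irrelevance.
Qed.

Fact dsum0_subproof : exists N, forall n, (N <= n)%N -> (0 : G n) = 0.
Proof. by exists 0%N. Qed.
Definition dsum_zero : dsum G := Dsum dsum0_subproof.

Fact dsumN_subproof x : exists N, forall n, (N <= n)%N -> - x n = 0.
Proof. by case: x => f [N hN]; exists N => n /hN /= ->; rewrite oppr0. Qed.
Definition dsum_opp x : dsum G := Dsum (dsumN_subproof x).

Fact dsumD_subproof x y : exists N, forall n, (N <= n)%N -> x n + y n = 0.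
Proof.
case: x y => [f [N hN]] [g [M hM]]; exists (maxn N M) => n /=.
by rewrite geq_max => /andP[/hN -> /hM ->]; rewrite addr0.
Qed.
Definition dsum_add x y : dsum G := Dsum (dsumD_subproof x y).

Fact dsumZ_subproof (c : K) x : exists N, forall n, (N <= n)%N -> c *: x n = 0.
Proof. by case: x => f [N hN]; exists N => n /hN /= ->; rewrite scaler0. Qed.
Definition dsum_scale (c : K) x : dsum G := Dsum (dsumZ_subproof c x).

Fact dsum_addA : associative dsum_add.
Proof. by move=> x y z; apply: dsumP => n; apply: addrA. Qed.
Fact dsum_addC : commutative dsum_add.
Proof. by move=> x y; apply: dsumP => n; apply: addrC. Qed.
Fact dsum_add0 : left_id dsum_zero dsum_add.
Proof. by move=> x; apply: dsumP => n; apply: add0r. Qed.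
Fact dsum_addN : left_inverse dsum_zero dsum_opp dsum_add.
Proof. by move=> x; apply: dsumP => n; apply: addNr. Qed.
HB.instance Definition _ := GRing.isZmodule.Build (dsum G)
  dsum_addA dsum_addC dsum_add0 dsum_addN.

Fact dsum_scaleA a b x : dsum_scale a (dsum_scale b x) = dsum_scale (a * b) x.
Proof. by apply: dsumP => n; apply: scalerA. Qed.
Fact dsum_scale1 : left_id 1 dsum_scale.
Proof. by move=> x; apply: dsumP => n; apply: scale1r. Qed.
Fact dsum_scaleDr : right_distributive dsum_scale +%R.
Proof. by move=> a x y; apply: dsumP => n; apply: scalerDr. Qed.
Fact dsum_scaleDl x : {morph dsum_scale^~ x : a b / a + b}.
Proof. by move=> a b; apply: dsumP => n; apply: scalerDl. Qed.
HB.instance Definition _ := GRing.Zmodule_isLmodule.Build K (dsum G)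
  dsum_scaleA dsum_scale1 dsum_scaleDr dsum_scaleDl.

Fact dinj_subproof (k : nat) (v : G k) :
  exists N, forall n, (N <= n)%N -> dfwith (fun i => 0 : G i) v n = 0.
Proof.
exists k.+1 => n lt_kn; rewrite dfwith_out //.
by apply: contraTneq lt_kn => ->; rewrite ltnn.
Qed.
Definition dinj (k : nat) (v : G k) : dsum G := Dsum (dinj_subproof v).

(* The element with components [g n].  The value 0 for a family [g] with
   infinitely many nonzero components is never used for a vertex operator
   algebra, its modules and a level-preserving map: see [contragredientE],
   [Y_WW'_V'E] and [transposeE]. *)
Definition dmk (g : forall n, G n) : dsum G :=
  match pselect (exists N, forall n, (N <= n)%N -> g n = 0) with
  | left h => Dsum h
  | right _ => 0
  end.

Lemma dmkE (g : forall n, G n) :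
  (exists N, forall n, (N <= n)%N -> g n = 0) -> forall n, dmk g n = g n.
Proof. by rewrite /dmk; case: pselect. Qed.

Definition homog (k : nat) (x : dsum G) : Prop := forall n, n <> k -> x n = 0.

End DirectSum.

Definition gdual (K : fieldType) (G : nat -> vectType K) : nat -> vectType K :=
  fun n => 'Hom(G n, K^o).

Definition pairing (K : fieldType) (G : nat -> vectType K)
    (f : dsum (gdual G)) (u : dsum G) : K :=
  \sum_(n \in [set: nat]) (f n (u n) : K).

Definition level_preserving (K : fieldType) (G H : nat -> vectType K)
    (T : dsum G -> dsum H) : Prop :=
  forall n u, homog n u -> homog n (T u).

(* T^* : V' -> W' for T : W -> V. *)
Definition transpose (K : fieldType) (G H : nat -> vectType K)
    (T : dsum G -> dsum H) (f : dsum (gdual H)) : dsum (gdual G) :=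
  dmk (fun n => linfun (fun u : G n => pairing f (T (dinj u)) : K^o) : gdual G n).

(* [p : fser M] is the formal distribution sum_n (p n) z^n in M[[z, z^-1]]. *)
Definition fser (M : Type) := int -> M.

Section FormalSeries.
Variables (K : fieldType) (M N : lmodType K).
Implicit Types p : fser M.

Definition Res (m : int) p : M := p (- m - 1). (* Res_z z^m p(z) *)
Definition sneg p : fser M := fun n => (-1) ^ n *: p n. (* p(-z) *)
Definition sinv p : fser M := fun n => p (- n). (* p(z^-1) *)
Definition scst (x : M) : fser M := fun n => if n == 0 then x else 0.

(* e^{c z L} p(z) *)
Definition sexp (c : K) (L : M -> M) p : fser M := fun n =>
  \sum_(j \in [set: nat]) (c ^+ j / j`!%:R) *: iter j L (p (n - j%:Z)).

(* sum_k F(A_k)(z) z^k for A(z) = sum_k A_k z^k: the substitution of a series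
   into a map linear in its argument. *)
Definition sbind (F : M -> fser N) (A : fser M) : fser N := fun n =>
  \sum_(k \in [set: int]) F (A k) (n - k).

End FormalSeries.

(* (-z^{-2})^{L(0)} a, where L(0) is n on the piece of degree n. *)
Definition szL0 (K : fieldType) (G : nat -> vectType K) (a : dsum G) :
    fser (dsum G) := fun n =>
  \sum_(k \in [set k : nat | n = - (k%:Z *+ 2)]) (-1) ^+ k *: dinj (a k).

(* e^{c z L} (-z^{-2})^{L(0)} a *)
Definition sconj (K : fieldType) (G : nat -> vectType K) (c : K)
    (L1 : dsum G -> dsum G) (a : dsum G) : fser (dsum G) :=
  sexp c L1 (szL0 a).

(* u, a |-> e^{z L(-1)} Y(a, -z) u *)
Definition skewsym (K : fieldType) (A B C : lmodType K)
    (Lm1 : C -> C) (Y : A -> B -> fser C) : B -> A -> fser C :=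
  fun u a => sexp 1 Lm1 (sneg (Y a u)).

(* The operator Y' with
   < Y'(a,z) f, b > = < f, Y(e^{zL(1)} (-z^{-2})^{L(0)} a, z^{-1}) b >. *)
Definition adjoint (K : fieldType) (A B C : nat -> vectType K)
    (L1 : dsum A -> dsum A) (Y : dsum A -> dsum B -> fser (dsum C)) :
    dsum A -> dsum (gdual C) -> fser (dsum (gdual B)) := fun a f n =>
  dmk (fun k => linfun (fun b : B k => pairing f
    (sbind (fun a' => sinv (Y a' (dinj b))) (sconj 1 L1 a) n) : K^o) : gdual B k).

Record vertexData (K : fieldType) := VertexData {
  vpiece :> nat -> vectType K;
  vY : dsum vpiece -> dsum vpiece -> fser (dsum vpiece);
  vac : dsum vpiece;
  conf : dsum vpiece }.

Record moduleData (K : fieldType) (V : vertexData K) := ModuleData {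
  mpiece :> nat -> vectType K;
  mY : dsum V -> dsum mpiece -> fser (dsum mpiece) }.

Definition adjoint_module (K : fieldType) (V : vertexData K) : moduleData V :=
  ModuleData (@vY K V).

Section VOA.
Variable K : fieldType.

(* The generalized binomial coefficient n (n-1) ... (n-i+1) / i!. *)
Definition zbinom (n : int) (i : nat) : K :=
  (\prod_(0 <= j < i) (n - j%:Z)%:~R) / i`!%:R.

Variable V : vertexData K.

(* a_m b = Res_z z^m Y_V(a,z) b *)
Definition vmode (a : dsum V) (m : int) (b : dsum V) : dsum V := Res m (vY a b).
(* L(n) = omega_{n+1} *)
Definition vL (n : int) : dsum V -> dsum V := vmode (conf V) (n + 1).

Definition mmode (W : moduleData V) (a : dsum V) (m : int) (u : dsum W) : dsum W :=
  Res m (mY a u).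
Definition mL (W : moduleData V) (n : int) : dsum W -> dsum W :=
  mmode (conf V) (n + 1).

(* The coefficient of z0^{-l-1} z1^{-m-1} z2^{-n-1} in the Jacobi identity
     z0^{-1} delta((z1-z2)/z0) Y(a,z1) Y(b,z2) u
       - z0^{-1} delta((z2-z1)/(-z0)) Y(b,z2) Y(a,z1) u
     = z2^{-1} delta((z1-z0)/z2) Y(Y_V(a,z0) b, z2) u. *)
Definition jacobi (W : moduleData V) : Prop :=
  forall (a b : dsum V) (u : dsum W) (l m n : int),
    \sum_(i \in [set: nat]) ((-1) ^+ i * zbinom l i) *:
        (mmode a (l + m - i%:Z) (mmode b (n + i%:Z) u)
         - (-1) ^ l *: mmode b (l + n - i%:Z) (mmode a (m + i%:Z) u))
    = \sum_(i \in [set: nat]) zbinom m i *: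
        mmode (vmode a (l + i%:Z) b) (m + n - i%:Z) u.

(* Ordinary modules of conformal weight 0. *)
Record is_module (W : moduleData V) : Prop := IsModule {
  m_linearl : forall u n, linear (fun a : dsum V => mY a u n : dsum W);
  m_linearr : forall a n, linear (fun u : dsum W => mY a u n);
  m_trunc : forall a (u : dsum W), exists N : int,
    forall m, N <= m -> mmode a m u = 0;
  m_vac : forall u : dsum W, mY (vac V) u = scst u;
  m_jacobi : jacobi W;
  m_grading : forall n (u : dsum W), homog n u -> mL 0 u = n%:R *: u }.

Record is_voa : Prop := IsVoa {
  v_linearl : forall b n, linear (fun a : dsum V => vY a b n);
  v_linearr : forall a n, linear (fun b : dsum V => vY a b n);
  v_trunc : forall a b : dsum V, exists N : int,
    forall m, N <= m -> vmode a m b = 0;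
  v_vac_deg : homog 0 (vac V);
  v_conf_deg : homog 2 (conf V);
  v_vac : forall b, vY (vac V) b = scst b;
  v_creation : forall a n, n <= 0 -> vY a (vac V) n = scst a n;
  v_jacobi : jacobi (adjoint_module V);
  v_virasoro : exists c : K, forall (m n : int) (b : dsum V),
    vL m (vL n b) - vL n (vL m b) =
      (m - n)%:~R *: vL (m + n) b
      + (if m + n == 0 then (m ^+ 3 - m)%:~R / 12%:R * c else 0) *: b;
  v_grading : forall n b, homog n b -> vL 0 b = n%:R *: b;
  v_deriv : forall a b n, vY (vL (-1) a) b n = (n + 1)%:~R *: vY a b (n + 1) }.

Definition contragredient (W : moduleData V) : moduleData V :=
  @ModuleData K V (gdual W) (adjoint (vL 1) (@mY K V W)).

End VOA.

Section RotaBaxter.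
Variables (K : fieldType) (V : vertexData K) (W : moduleData V).

Let V' : moduleData V := contragredient (adjoint_module V).
Let W' : moduleData V := contragredient W.

Definition Y_WV_W : dsum W -> dsum V -> fser (dsum W) :=
  skewsym (@mL K V W (-1)) (@mY K V W).
Definition Y_W'V_W' : dsum W' -> dsum V -> fser (dsum W') :=
  skewsym (@mL K V W' (-1)) (@mY K V W').
Definition Y_V'V_V' : dsum V' -> dsum V -> fser (dsum V') :=
  skewsym (@mL K V V' (-1)) (@mY K V V').
Definition Y_WW'_V' : dsum W -> dsum W' -> fser (dsum V') :=
  adjoint (@mL K V W 1) Y_WV_W.
Definition Y_W'W_V' : dsum W' -> dsum W -> fser (dsum V') :=
  skewsym (@mL K V V' (-1)) Y_WW'_V'.

Variable T : dsum W -> dsum V.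

Definition relative_RB (m : int) : Prop := forall u v : dsum W,
  vmode (T u) m (T v) = T (mmode (T u) m v) + T (Res m (Y_WV_W u (T v))).

Let Tstar : dsum V' -> dsum W' := transpose T.

Definition strong_relative_RB_at (m : int) : Prop :=
  [/\ level_preserving T, relative_RB m,
    (forall (u : dsum W) (f : dsum V'),
       Res m (fun n => mY (T u) (Tstar f) n - Tstar (mY (T u) f n)
                       + Tstar (Y_WW'_V' u (Tstar f) n)) = 0)
  & (forall (u : dsum W) (f : dsum V'),
       Res m (fun n => Y_W'V_W' (Tstar f) (T u) n - Tstar (Y_V'V_V' f (T u) n)
                       + Tstar (Y_W'W_V' (Tstar f) u n)) = 0)].

Definition strong_relative_RB : Prop := forall m, strong_relative_RB_at m.

End RotaBaxter.

Section Semidirect.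
Variable K : fieldType.

Section Pairs.
Variables G H : nat -> vectType K.

Definition gprod : nat -> vectType K := fun n => (G n * H n)%type : vectType K.

Fact dpair_subproof (a : dsum G) (f : dsum H) :
  exists N, forall n, (N <= n)%N -> (a n, f n) = 0 :> gprod n.
Proof.
case: a f => [a [N hN]] [f [M hM]]; exists (maxn N M) => n /=.
by rewrite geq_max => /andP[/hN -> /hM ->].
Qed.
Definition dpair (a : dsum G) (f : dsum H) : dsum gprod :=
  Dsum (dpair_subproof a f).

Fact dfst_subproof (x : dsum gprod) :
  exists N, forall n, (N <= n)%N -> (x n).1 = 0.
Proof. by case: x => x [N hN]; exists N => n /hN /= ->. Qed.
Definition dfst (x : dsum gprod) : dsum G := Dsum (dfst_subproof x).

Fact dsnd_subproof (x : dsum gprod) :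
  exists N, forall n, (N <= n)%N -> (x n).2 = 0.
Proof. by case: x => x [N hN]; exists N => n /hN /= ->. Qed.
Definition dsnd (x : dsum gprod) : dsum H := Dsum (dsnd_subproof x).

End Pairs.

Variables (V : vertexData K) (W : moduleData V).
Let W' : moduleData V := contragredient W.

Definition Y_semi (x y : dsum (gprod V W')) : fser (dsum (gprod V W')) := fun n =>
  dpair (vY (dfst x) (dfst y) n)
    (mY (dfst x) (dsnd y : dsum W') n + Y_W'V_W' (dsnd x) (dfst y) n).

Definition semidirect : vertexData K :=
  @VertexData K (gprod V W') Y_semi (dpair (vac V) 0) (dpair (conf V) 0).

End Semidirect.

Section Tensor.
Variable K : fieldType.

(* A (x) B realized as Hom(A^*, B); see [tlift_pure] and [tlift_uniq] for its
   universal property. *)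
Definition tens (A B : vectType K) : vectType K := 'Hom('Hom(A, K^o), B).

Definition pure (A B : vectType K) (a : A) (b : B) : tens A B :=
  linfun (fun f : 'Hom(A, K^o) => (f a : K) *: b).

(* The i-th vector of the basis dual to X. *)
Definition dual_vec (A : vectType K) (n : nat) (X : n.-tuple A) (i : 'I_n) :
    'Hom(A, K^o) := linfun (coord X i : A -> K^o).

(* The linear map A (x) B -> E induced by a bilinear map. *)
Definition tlift (A B E : vectType K) (beta : A -> B -> E) (t : tens A B) : E :=
  \sum_(i < \dim (fullv : {vspace A}))
    beta (vbasis fullv)`_i (t (dual_vec (vbasis fullv) i)).

Definition flip (A B : vectType K) : tens A B -> tens B A :=
  tlift (fun a b => pure b a).

Definition tens3 (A B C : vectType K) : vectType K := tens (tens A B) C.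
Definition pure3 (A B C : vectType K) (a : A) (b : B) (c : C) : tens3 A B C :=
  pure (pure a b) c.

Lemma linfunE (A B : vectType K) (f : A -> B) : linear f -> linfun f =1 f.
Proof.
move=> lf; pose m := GRing.isLinear.Build K A B _ f lf.
pose F : {linear A -> B} := HB.pack f m.
exact: (lfunE F).
Qed.

Lemma pureE (A B : vectType K) (a : A) (b : B) f : pure a b f = (f a : K) *: b.
Proof.
rewrite /pure linfunE // => c g h.
by rewrite add_lfunE scale_lfunE scalerDl scalerA.
Qed.

Lemma dual_vecE (A : vectType K) n (X : n.-tuple A) i a :
  dual_vec X i a = coord X i a.
Proof. exact: (lfunE (coord X i : {linear A -> K^o})). Qed.

Lemma tens_decomp (A B : vectType K) (t : tens A B) :
  t = \sum_(i < \dim (fullv : {vspace A}))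
        pure (vbasis fullv)`_i (t (dual_vec (vbasis fullv) i)).
Proof.
apply/lfunP => f; rewrite sum_lfunE.
have -> : f = \sum_(i < \dim (fullv : {vspace A}))
    (f (vbasis fullv)`_i : K) *: dual_vec (vbasis fullv) i.
  apply/lfunP => a; rewrite {1}(coord_vbasis (memvf a)) linear_sum sum_lfunE.
  apply: eq_bigr => i _; rewrite linearZ scale_lfunE dual_vecE.
  exact: mulrC.
rewrite linear_sum; apply: eq_bigr => i _; rewrite linearZ pureE; congr (_ *: _).
have free := basis_free (vbasisP (fullv : {vspace A})).
rewrite sum_lfunE (bigD1 i) //= big1 => [|j ji].
  by rewrite addr0 scale_lfunE dual_vecE coord_free // eqxx [RHS]mulr1.
by rewrite scale_lfunE dual_vecE coord_free // eq_sym (negPf ji) scaler0.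
Qed.

Lemma tlift_pure (A B E : vectType K) (beta : A -> B -> E) (a : A) (b : B) :
  (forall b, linear (beta^~ b)) -> (forall a, linear (beta a)) ->
  tlift beta (pure a b) = beta a b.
Proof.
move=> hl hr.
pose L : {linear A -> E} := HB.pack (beta^~ b)
  (GRing.isLinear.Build K A E _ (beta^~ b) (hl b)).
rewrite -[RHS]/(L a) [in RHS](coord_vbasis (memvf a)) linear_sum.
apply: eq_bigr => i _; rewrite linearZ pureE dual_vecE.
pose R : {linear B -> E} := HB.pack (beta (vbasis fullv)`_i)
  (GRing.isLinear.Build K B E _ _ (hr (vbasis fullv)`_i)).
by rewrite -[LHS]/(R _) linearZ.
Qed.

Lemma tlift_uniq (A B E : vectType K) (f g : {linear tens A B -> E}) :
  (forall a b, f (pure a b) = g (pure a b)) -> f =1 g.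
Proof.
move=> e t; rewrite (tens_decomp t) !linear_sum.
by apply: eq_bigr => i _; apply: e.
Qed.

End Tensor.

Section VOYBE.
Variables (K : fieldType) (U : vertexData K).

Definition dot (m : int) (x y : dsum U) : dsum U := vmode y m x.

Definition dot' (m : int) (x y : dsum U) : dsum U :=
  Res m (sbind (fun a => sinv (vY a y)) (sconj 1 (vL 1) x)).

Definition dot'op (m : int) (x y : dsum U) : dsum U :=
  Res m (sbind (fun b => sbind (fun a => sneg (sinv (vY a b)))
                               (sconj (-1) (vL 1) y))
               (sexp 1 (vL 1) (scst x))).

(* prod_t U(t) (x) U(t) and the product of all U(p) (x) U(q) (x) U(s) *)
Definition tensor2 := forall t : nat, tens (U t) (U t).
Definition tensor3 := forall p q s : nat, tens3 (U p) (U q) (U s).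

Definition in_SD (r : tensor2) : Prop := forall t, flip (r t) = - r t.

(* In each product two legs are untouched; at the component (p, q, s) their
   degrees fix the only components of [r] that contribute to the double sum. *)
Definition r12_r13 (m : int) (r : tensor2) : tensor3 := fun p q s =>
  tlift (fun x y => tlift (fun x' y' =>
    pure3 (dot m (dinj x) (dinj x') p) y y') (r s)) (r q).

Definition r23_r12 (m : int) (r : tensor2) : tensor3 := fun p q s =>
  tlift (fun x y => tlift (fun x' y' =>
    pure3 x (dot' m (dinj x') (dinj y) q) y') (r s)) (r p).

Definition r13_r23 (m : int) (r : tensor2) : tensor3 := fun p q s =>
  tlift (fun x y => tlift (fun x' y' =>
    pure3 x x' (dot'op m (dinj y) (dinj y') s)) (r q)) (r p).

Definition VOYBE_at (m : int) (r : tensor2) : Prop := forall p q s,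
  r12_r13 m r p q s - r23_r12 m r p q s + r13_r23 m r p q s = 0.

Definition VOYBE_solution (r : tensor2) : Prop :=
  in_SD r /\ forall m, VOYBE_at m r.

End VOYBE.

Section SkewTensor.
Variables (K : fieldType) (V : vertexData K) (W : moduleData V).
Variables (T : dsum W -> dsum V) (d : nat -> nat).
Variable v : forall t, (d t).-tuple (W t).

Let inV t (a : V t) : semidirect W t := (a, 0).
Let inW' t (f : gdual W t) : semidirect W t := (0, f).

(* T, as the tensor sum_t sum_i T(v_i^t) (x) (v_i^t)^* *)
Definition T_tensor : tensor2 (semidirect W) := fun t =>
  \sum_(i < d t) pure (inV (T (dinj (tnth (v t) i)) t)) (inW' (dual_vec (v t) i)).

(* T - sigma(T) *)
Definition skew_tensor : tensor2 (semidirect W) := fun t =>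
  \sum_(i < d t)
    (pure (inV (T (dinj (tnth (v t) i)) t)) (inW' (dual_vec (v t) i))
     - pure (inW' (dual_vec (v t) i)) (inV (T (dinj (tnth (v t) i)) t))).

End SkewTensor.

Section Adequacy.
Variable K : fieldType.

Lemma fs_ind (I : choiceType) (M : nmodType) (P : M -> Prop) (D : set I)
    (F : I -> M) :
  P 0 -> (forall x y, P x -> P y -> P (x + y)) -> (forall i, P (F i)) ->
  P (\sum_(i \in D) F i).
Proof. by move=> P0 PD PF; apply: big_ind. Qed.

Lemma fs_finite (I : choiceType) (M : nmodType) (r : seq I) (F : I -> M) :
  uniq r -> (forall i, i \notin r -> F i = 0) ->
  \sum_(i \in [set: I]) F i = \sum_(i <- r) F i.
Proof.
move=> ur Fr; rewrite (fsbigE r) // => [|i _ /Fr //].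
by apply: eq_bigl => i; rewrite in_setT.
Qed.

Section Linear.
Variables (A B : lmodType K) (f : A -> B).
Hypothesis lf : linear f.
Let L : {linear A -> B} := HB.pack f (GRing.isLinear.Build K A B _ f lf).
Lemma lin0 : f 0 = 0. Proof. exact: (linear0 L). Qed.
Lemma linD x y : f (x + y) = f x + f y. Proof. exact: (linearD L). Qed.
Lemma linZ c x : f (c *: x) = c *: f x. Proof. exact: (linearZ_LR L). Qed.
Lemma lin_sum (I : Type) (r : seq I) (F : I -> A) :
  f (\sum_(i <- r) F i) = \sum_(i <- r) f (F i).
Proof. exact: (linear_sum L). Qed.
End Linear.

Section Pieces.
Variable G : nat -> vectType K.

Lemma dsum_sumE (I : Type) (r : seq I) (F : I -> dsum G) n :
  (\sum_(i <- r) F i) n = \sum_(i <- r) F i n.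
Proof. exact: (big_morph (fun x : dsum G => x n)). Qed.

Lemma dinj_homog k (v : G k) : homog k (dinj v).
Proof. by move=> n nk; rewrite /= dfwith_out //; apply/eqP => e; apply: nk. Qed.

Lemma dinjE k (v : G k) : dinj v k = v.
Proof. exact: dfwith_in. Qed.

Lemma dinj_linear k : linear (@dinj K G k).
Proof.
move=> c x y; apply: dsumP => n; rewrite [RHS]/=.
case: (eqVneq k n) => [<-|kn]; first by rewrite /= !dfwith_in.
by rewrite /= !dfwith_out // scaler0 addr0.
Qed.

Lemma dsum_decomp (x : dsum G) N : (forall n, (N <= n)%N -> x n = 0) ->
  x = \sum_(k <- iota 0 N) dinj (x k).
Proof.
move=> xN; apply: dsumP => n; rewrite dsum_sumE.
have [nN|Nn] := ltnP n N.
  rewrite (bigD1_seq n) ?mem_iota ?iota_uniq //= dfwith_in big1 ?addr0 // => k kn.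
  by rewrite dfwith_out.
rewrite xN // big_seq big1 // => k; rewrite mem_iota /= => kN.
by rewrite dfwith_out //; apply: contraTneq Nn => <-; rewrite -ltnNge.
Qed.

Lemma pairing_iota (f : dsum (gdual G)) M (y : dsum G) :
  (forall n, (M <= n)%N -> f n = 0) ->
  pairing f y = \sum_(k <- iota 0 M) f k (y k).
Proof.
move=> fM; apply: fs_finite; first exact: iota_uniq.
by move=> i; rewrite mem_iota /= -leqNgt => /fM ->; rewrite zero_lfunE.
Qed.

Lemma pairing_linear (f : dsum (gdual G)) : linear (pairing f : _ -> K^o).
Proof.
move=> c x y; have [M fM] := dsum_fin f.
rewrite !(pairing_iota _ fM) scaler_sumr -big_split /=.
by apply: eq_bigr => k _; rewrite linearD linearZ.
Qed.

Lemma homog_iter (L1 : dsum G -> dsum G) : L1 0 = 0 ->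
  (forall k x, homog k.+1 x -> homog k (L1 x)) ->
  (forall x, homog 0 x -> L1 x = 0) ->
  forall j k x, homog k x ->
  iter j L1 x = 0 \/ (j <= k)%N /\ homog (k - j) (iter j L1 x).
Proof.
move=> L0 LS Lz; elim=> [|j IH] k x hx /=; first by right; rewrite subn0.
have [->|[jk h]] := IH k x hx; first by left.
have [kj|kj] := eqVneq k j; first by left; rewrite Lz // -[0%N](subnn j) -{1}kj.
right; have jk' : (j < k)%N by rewrite ltn_neqAle eq_sym kj.
by split=> //; apply: LS; rewrite -subSn.
Qed.

(* The terms of the coefficient of z^c in e^{zL(1)} (-z^{-2})^{L(0)} a. *)
Lemma sconj_terms (L1 : dsum G -> dsum G) (a : dsum G) N (P : dsum G -> Prop)
    (s : K) (c : int) :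
  linear L1 -> (forall k x, homog k.+1 x -> homog k (L1 x)) ->
  (forall x, homog 0 x -> L1 x = 0) ->
  (forall n, (N <= n)%N -> a n = 0) ->
  P 0 -> (forall x y, P x -> P y -> P (x + y)) ->
  (forall d x, P x -> P (d *: x)) ->
  (forall k e x, (e <= k < N)%N -> c = - (k%:Z + e%:Z) -> homog e x -> P x) ->
  P (sconj s L1 a c).
Proof.
move=> lL LS Lz aN P0 PD PZ PH; apply: fs_ind => // j; apply: PZ.
rewrite /szL0; set D := [set k : nat | _].
have [[k Dk]|D0] := pselect (exists k, D k); last first.
  rewrite fsbig1 => [|k Dk]; last by case: D0; exists k.
  by elim: j {D D0} => //= j IH; rewrite -iterS iterSr (lin0 lL).
have -> : D = [set k].
  apply/seteqP; split=> i /=; last by move->.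
  move: Dk; rewrite /D /= => -> /eqP; rewrite eqr_opp => /eqP e.
  by move: e; rewrite !mulr2n; lia.
rewrite fsbig_set1.
have [Nk|kN] := leqP N k.
  rewrite aN // (lin0 (@dinj_linear k)) scaler0.
  by elim: j {D Dk} => //= j IH; rewrite -iterS iterSr (lin0 lL).
have hx : homog k ((-1) ^+ k *: dinj (a k) : dsum G).
  by move=> n nk; rewrite /= dfwith_out ?scaler0 //; apply/eqP => e; apply: nk.
have [->//|[jk h]] := homog_iter (lin0 lL) LS Lz j hx.
apply: (PH k (k - j)%N) => //; first by rewrite leq_subr.
by move: Dk; rewrite /D /= mulr2n; lia.
Qed.

End Pieces.

Variables A B C : nat -> vectType K.
Variables (L1 : dsum A -> dsum A) (Y : dsum A -> dsum B -> fser (dsum C)).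
Hypothesis L1_linear : linear L1.
Hypothesis L1_deg : forall k x, homog k.+1 x -> homog k (L1 x).
Hypothesis L1_deg0 : forall x, homog 0 x -> L1 x = 0.
Hypothesis Y_linl : forall b n, linear (fun a => Y a b n).
Hypothesis Y_linr : forall a n, linear (fun b => Y a b n).
Hypothesis Y_deg : forall p q n a b k, homog p a -> homog q b ->
  k%:Z <> p%:Z + q%:Z + n -> Y a b n k = 0.

Let S (a : dsum A) (n : int) (b : dsum B) : dsum C :=
  sbind (fun a' => sinv (Y a' b)) (sconj 1 L1 a) n.

Let S_linear a n : linear (S a n).
Proof.
have [N aN] := dsum_fin a.
pose r := [seq - (i%:Z) | i <- iota 0 (2 * N)].
have ur : uniq r.
  by rewrite map_inj_uniq ?iota_uniq // => i j /eqP; rewrite eqr_opp => /eqP [].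
have out c : c \notin r -> sconj 1 L1 a c = 0.
  move=> cr; apply: (sconj_terms (N := N) (P := fun x => x = 0)) => //.
  - by move=> x y -> ->; rewrite addr0.
  - by move=> d x ->; rewrite scaler0.
  move=> k e x /andP[ek kN] ec; case/negP: cr; apply/mapP.
  by exists (k + e)%N; rewrite ?mem_iota //=; lia.
have SE b : S a n b = \sum_(c <- r) Y (sconj 1 L1 a c) b (- (n - c)).
  by apply: fs_finite => // c /out ->; apply: (lin0 (Y_linl b _)).
move=> d x y; rewrite !SE scaler_sumr -big_split /=.
by apply: eq_bigr => c _; apply: Y_linr.
Qed.

Lemma adjoint_fin a (f : dsum (gdual C)) n : exists Q, forall k, (Q <= k)%N ->
  forall b : B k, pairing f (S a n (dinj b)) = 0.
Proof.
have [N aN] := dsum_fin a; have [M fM] := dsum_fin f.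
exists (M + N + `|n|)%N => q qQ b; rewrite (pairing_iota _ fM) big_seq big1 // => i.
rewrite mem_iota /= => iM; rewrite (_ : S a n (dinj b) i = 0) ?linear0 //.
apply: (@fs_ind _ _ (fun y : dsum C => y i = 0)) => // [x y /= -> ->|c].
  exact: addr0.
rewrite /sinv; apply: (sconj_terms (N := N)
  (P := fun x => Y x (dinj b) (- (n - c)) i = 0)) => //.
- by rewrite (lin0 (Y_linl _ _)).
- by move=> x y hx hy; rewrite (linD (Y_linl _ _)) /= hx hy addr0.
- by move=> d x hx; rewrite (linZ (Y_linl _ _)) /= hx scaler0.
move=> k e x /andP[ek kN] ec hx; apply: (Y_deg hx (dinj_homog b)).
by lia.
Qed.

Lemma adjointE a (f : dsum (gdual C)) n (b : dsum B) :
  pairing (adjoint L1 Y a f n) b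
  = pairing f (sbind (fun a' => sinv (Y a' b)) (sconj 1 L1 a) n).
Proof.
have [Q hQ] := adjoint_fin a f n; have [N bN] := dsum_fin b.
have lfun k : linear (fun b : B k => pairing f (S a n (dinj b)) : K^o).
  by move=> c x y; rewrite dinj_linear S_linear pairing_linear.
have adjE k : adjoint L1 Y a f n k
    = linfun (fun b : B k => pairing f (S a n (dinj b)) : K^o).
  rewrite /adjoint dmkE //; exists Q => {}k /hQ h; apply/lfunP => x.
  by rewrite linfunE // zero_lfunE h.
rewrite -/(S a n b) (pairing_iota (M := maxn Q N)); last first.
  move=> k; rewrite geq_max => /andP[/hQ h _]; rewrite adjE.
  by apply/lfunP => x; rewrite linfunE // zero_lfunE h.
rewrite [in RHS](dsum_decomp (N := maxn Q N) (x := b)) => [|k]; last first.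
  by rewrite geq_max => /andP[_ /bN].
rewrite (lin_sum (S_linear a n)) (lin_sum (pairing_linear f)).
by apply: eq_bigr => k _; rewrite adjE linfunE.
Qed.

Lemma transposeE (G H : nat -> vectType K) (T : dsum G -> dsum H)
    (f : dsum (gdual H)) (u : dsum G) :
  linear T -> level_preserving T -> pairing (transpose T f) u = pairing f (T u).
Proof.
move=> lT hT; have [M fM] := dsum_fin f; have [N uN] := dsum_fin u.
have h0 k (x : G k) : (M <= k)%N -> pairing f (T (dinj x)) = 0.
  move=> Mk; rewrite (pairing_iota _ fM) big_seq big1 // => i.
  rewrite mem_iota /= => iM; rewrite (hT k) ?linear0 //; first exact: dinj_homog.
  by move=> e; move: Mk; rewrite -e leqNgt iM.
have lfun k : linear (fun x : G k => pairing f (T (dinj x)) : K^o).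
  by move=> c x y; rewrite dinj_linear lT pairing_linear.
have tE k : transpose T f k = linfun (fun x : G k => pairing f (T (dinj x)) : K^o).
  rewrite /transpose dmkE //; exists M => {}k Mk; apply/lfunP => x.
  by rewrite linfunE // zero_lfunE h0.
rewrite (pairing_iota (M := maxn M N)); last first.
  move=> k; rewrite geq_max => /andP[Mk _]; rewrite tE.
  by apply/lfunP => x; rewrite linfunE // zero_lfunE h0.
rewrite [in RHS](dsum_decomp (N := maxn M N) (x := u)) => [|k]; last first.
  by rewrite geq_max => /andP[_ /uN].
rewrite (lin_sum lT) (lin_sum (pairing_linear f)).
by apply: eq_bigr => k _; rewrite tE linfunE.
Qed.

End Adequacy.

Section Grading.
Variables (K : numFieldType) (V : vertexData K).
Hypothesis hV : is_voa V.

Lemma zbinom0 i : zbinom K 0 i = (i == 0%N)%:R.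
Proof.
case: i => [|i]; first by rewrite /zbinom big_nil divr1.
by rewrite /zbinom big_nat_recl //= subr0 mul0r mul0r.
Qed.

Lemma zbinom1 i : zbinom K 1 i = (i <= 1)%:R.
Proof.
case: i => [|[|i]]; rewrite /zbinom ?big_nil ?divr1 //.
  by rewrite big_nat1 subr0.
by rewrite 2?big_nat_recl //= (subrr (1 : int)) mul0r mulr0 mul0r.
Qed.

Lemma zbinomN2 i : (-1) ^+ i * zbinom K (-2) i = i.+1%:R.
Proof.
suff -> : zbinom K (-2) i = (-1) ^+ i * i.+1%:R.
  by rewrite mulrA -exprMn mulrNN mulr1 expr1n mul1r.
rewrite /zbinom; apply: (canLR (mulfK _)); first by rewrite pnatr_eq0 -lt0n fact_gt0.
elim: i => [|i IH]; first by rewrite big_nil expr0 !mulr1.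
rewrite big_nat_recr //= IH exprS factS natrM.
have -> : (-2 - i%:Z)%:~R = - i.+2%:R :> K.
  by rewrite -[i.+2%:R]/(i.+2%:Z%:~R) -mulrNz; congr (_%:~R); lia.
by move: ((-1) ^+ i) (i`!%:R) => x y; ring.
Qed.

Variable W : moduleData V.
Hypothesis hW : is_module W.

Lemma mmode_linearl u m : linear (fun a : dsum V => mmode a m u : dsum W).
Proof. by move=> c x y; apply: (m_linearl hW). Qed.
Lemma mmode_linearr a m : linear (fun u : dsum W => mmode a m u).
Proof. by move=> c x y; apply: (m_linearr hW). Qed.

Lemma mL_linear j : linear (@mL K V W j).
Proof. exact: mmode_linearr. Qed.

Lemma mmode_vac m (u : dsum W) : mmode (vac V) m u = if m == -1 then u else 0.
Proof.
rewrite /mmode /Res (m_vac hW) /scst; congr (if _ then _ else _).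
by apply/eqP/eqP; lia.
Qed.

Lemma mmode_deriv a m (u : dsum W) :
  mmode (vL (-1) a) m u = (- m)%:~R *: mmode a (m - 1) u.
Proof.
have -> : vL (-1) a = vmode a (-2) (vac V).
  have /= := v_creation hV (vL (-1) a) (lexx 0).
  by rewrite /scst eqxx => <-; rewrite (v_deriv hV) add0r scale1r.
have := m_jacobi hW a (vac V) u (-2) 0 m.
rewrite [RHS](fs_finite (r := [:: 0%N])) // => [|i]; last first.
  by rewrite inE zbinom0 => /negPf ->; rewrite scale0r.
rewrite big_seq1 zbinom0 scale1r !addr0 ?subr0 add0r => <-.
have a0 j : mmode a j (0 : dsum W) = 0 by apply: (lin0 (mmode_linearr a j)).
have sg : (-1 : K) ^ (-2 : int) = 1 by rewrite -exprnN sqrrN expr1n invr1.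
under eq_fsbigr do rewrite zbinomN2 sg scale1r !mmode_vac.
have [m0|m0|m0] := ltgtP m 0.
- rewrite (fs_finite (r := [:: absz (m + 1)])) // => [|i]; last first.
    rewrite inE => /eqP ne; rewrite !ifF ?a0 ?subr0 ?scaler0 //; apply/eqP; lia.
  rewrite big_seq1 ifT; last by apply/eqP; lia.
  rewrite ifF ?subr0; last by apply/eqP; lia.
  by congr (_ *: mmode _ _ _); last (by lia);
     rewrite -[LHS]/(_%:Z%:~R); congr (_%:~R); lia.
- rewrite (fs_finite (r := [:: absz (m - 1)])) // => [|i]; last first.
    rewrite inE => /eqP ne; rewrite !ifF ?a0 ?subr0 ?scaler0 //; apply/eqP; lia.
  rewrite big_seq1 ifF; last by apply/eqP; lia.
  rewrite ifT ?a0 ?sub0r; last by apply/eqP; lia.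
  rewrite scalerN -scaleNr; congr (_ *: mmode _ _ _); last by lia.
  by rewrite -[_%:R]/(_%:Z%:~R) -mulrNz; congr (_%:~R); lia.
rewrite m0 oppr0 scale0r fsbig1 // => i _.
by rewrite !ifF ?a0 ?subr0 ?scaler0 //; apply/eqP; lia.
Qed.

Lemma mL0E (x : dsum W) k : mL 0 x k = k%:R *: x k.
Proof.
have [N xN] := dsum_fin x.
have decN : forall n, (maxn N k.+1 <= n)%N -> x n = 0.
  by move=> n; rewrite geq_max => /andP[/xN].
rewrite [in LHS](dsum_decomp decN) (lin_sum (mL_linear 0)) dsum_sumE.
rewrite (bigD1_seq k) ?mem_iota ?iota_uniq ?leq_max ?ltnSn ?orbT //=.
rewrite big1 ?addr0 => [|i ik].
  by rewrite (m_grading hW (dinj_homog _)) /= dfwith_in.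
by rewrite (m_grading hW (dinj_homog _)) /= dfwith_out ?scaler0.
Qed.

Lemma mmode_deg p q m a (u : dsum W) k : homog p a -> homog q u ->
  k%:Z <> p%:Z + q%:Z - m - 1 -> mmode a m u k = 0.
Proof.
move=> ha hu; set d : int := _ - _ => ne.
have E : mL 0 (mmode a m u) = d%:~R *: mmode a m u.
  have := m_jacobi hW (conf V) a u 0 1 m.
  rewrite [LHS](fs_finite (r := [:: 0%N])) // => [|i]; last first.
    by rewrite inE zbinom0 => /negPf ->; rewrite mulr0 scale0r.
  rewrite [RHS](fs_finite (r := [:: 0%N; 1%N])) // => [|i]; last first.
    by rewrite !inE zbinom1; case: i => [|[|i]] //= _; rewrite scale0r.
  rewrite big_seq1 big_cons big_seq1 zbinom0 !zbinom1 mulr1 expr0 !scale1r.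
  rewrite !add0r !addr0 ?subr0.
  rewrite -[vmode (conf V) 0 a]/(vL (-1) a) -[vmode (conf V) 1 a]/(vL 0 a).
  rewrite -![mmode (conf V) 1 _]/(mL 0 _) mmode_deriv (v_grading hV ha).
  rewrite (m_grading hW hu) (linZ (mmode_linearl _ _)) (linZ (mmode_linearr _ _)).
  move=> /eqP; rewrite subr_eq => /eqP ->.
  rewrite (_ : 1 + m - 1 = m); last by lia.
  rewrite -!scalerDl; congr (_ *: _).
  rewrite -[p%:R]/(p%:Z%:~R) -[q%:R]/(q%:Z%:~R) -!mulrzDr; congr (_%:~R).
  by rewrite /d; lia.
have /eqP := congr1 (fun x : dsum W => x k) E.
rewrite mL0E /= -subr_eq0 -scalerBl scaler_eq0 => /orP[|/eqP //].
rewrite -[k%:R]/(k%:Z%:~R) -mulrzBr intr_eq0 subr_eq0 => /eqP e.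
by case: ne.
Qed.

Lemma mY_deg p q n a (u : dsum W) k : homog p a -> homog q u ->
  k%:Z <> p%:Z + q%:Z + n -> mY a u n k = 0.
Proof.
move=> ha hu ne; have := @mmode_deg p q (- n - 1) a u k ha hu.
rewrite /mmode /Res (_ : - (- n - 1) - 1 = n); last by lia.
by apply; lia.
Qed.

Lemma mL_deg j p q (x : dsum W) : q%:Z = p%:Z - j -> homog p x -> homog q (mL j x).
Proof.
move=> e hx k kq; apply: (mmode_deg (v_conf_deg hV) hx) => ek.
by apply: kq; lia.
Qed.

Lemma mL1_deg0 (x : dsum W) : homog 0 x -> mL 1 x = 0.
Proof.
move=> hx; apply: dsumP => k; apply: (mmode_deg (v_conf_deg hV) hx); lia.
Qed.

Lemma Y_WV_W_trunc (u : dsum W) a n : exists N, forall M, (N <= M)%N ->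
  Y_WV_W u a n = \sum_(j <- iota 0 M)
    (1 ^+ j / j`!%:R) *: iter j (@mL K V W (-1)) (sneg (mY a u) (n - j%:Z)).
Proof.
have [N hN] := m_trunc hW a u; exists (absz n + absz N).+1 => M NM.
apply: fs_finite => [|j]; first exact: iota_uniq.
rewrite mem_iota /= -leqNgt => Mj; rewrite /sneg.
have := hN (j%:Z - n - 1); rewrite /mmode /Res (_ : - (_ - 1) - 1 = n - j%:Z).
  move=> ->; last by lia.
  rewrite scaler0; elim: j {Mj} => [|j IH] /=; first by rewrite scaler0.
  have e i : iter i (@mL K V W (-1)) 0 = 0.
    by elim: i => //= i ->; apply: (lin0 (mL_linear _)).
  by rewrite e (lin0 (mL_linear _)) scaler0.
by lia.
Qed.

Let iter_linear j (x y : dsum W) c : iter j (@mL K V W (-1)) (c *: x + y)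
  = c *: iter j (@mL K V W (-1)) x + iter j (@mL K V W (-1)) y.
Proof. by elim: j => //= j ->; apply: mL_linear. Qed.

Lemma Y_WV_W_linearl a n : linear (fun u : dsum W => Y_WV_W u a n).
Proof.
move=> c x y; have [N1 e1] := Y_WV_W_trunc x a n.
have [N2 e2] := Y_WV_W_trunc y a n; have [N3 e3] := Y_WV_W_trunc (c *: x + y) a n.
rewrite (e1 (N1 + N2 + N3)%N) ?(e2 (N1 + N2 + N3)%N) ?(e3 (N1 + N2 + N3)%N); try lia.
rewrite scaler_sumr -big_split; apply: eq_bigr => j _ /=.
rewrite /sneg (m_linearr hW); move: (1 ^+ j / _) ((-1) ^ _) => d e.
by rewrite scalerDr (scalerA e c) (mulrC e) -scalerA iter_linear scalerDr !scalerA mulrC.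
Qed.

Lemma Y_WV_W_linearr (u : dsum W) n : linear (fun a : dsum V => Y_WV_W u a n).
Proof.
move=> c x y; have [N1 e1] := Y_WV_W_trunc u x n.
have [N2 e2] := Y_WV_W_trunc u y n; have [N3 e3] := Y_WV_W_trunc u (c *: x + y) n.
rewrite (e1 (N1 + N2 + N3)%N) ?(e2 (N1 + N2 + N3)%N) ?(e3 (N1 + N2 + N3)%N); try lia.
rewrite scaler_sumr -big_split; apply: eq_bigr => j _ /=.
rewrite /sneg (m_linearl hW); move: (1 ^+ j / _) ((-1) ^ _) => d e.
by rewrite scalerDr (scalerA e c) (mulrC e) -scalerA iter_linear scalerDr !scalerA mulrC.
Qed.

Lemma Y_WV_W_deg p q n (u : dsum W) a k : homog p u -> homog q a ->
  k%:Z <> p%:Z + q%:Z + n -> Y_WV_W u a n k = 0.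
Proof.
move=> hu ha ne; apply: (@fs_ind _ _ (fun x : dsum W => x k = 0)) => //.
  by move=> x y /= -> ->; rewrite addr0.
move=> j /=; suff -> : iter j (@mL K V W (-1)) (sneg (mY a u) (n - j%:Z)) k = 0.
  exact: scaler0.
have [D0|D0] := leP 0 (p%:Z + q%:Z + n - j%:Z); last first.
  have -> : sneg (mY a u) (n - j%:Z) = 0.
    apply: dsumP => i; rewrite /sneg /= (mY_deg ha hu) ?scaler0 //; lia.
  suff -> : iter j (@mL K V W (-1)) 0 = 0 by [].
  by elim: j {D0} => //= j ->; apply: (lin0 (mL_linear _)).
have h : homog (absz (p%:Z + q%:Z + n - j%:Z)%R) (sneg (mY a u) (n - j%:Z)).
  by move=> i hi; rewrite /sneg /= (mY_deg ha hu) ?scaler0 //; lia.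
have hj i d x : homog d x -> homog (d + i) (iter i (@mL K V W (-1)) x).
  move=> hx; elim: i => [|i IH] /=; first by rewrite addn0.
  by apply: mL_deg IH; lia.
by apply: (hj j _ _ h); lia.
Qed.

(* < Y_{WW'}^{V'}(u,z) f, a > = < f, Y_{WV}^W(e^{zL(1)} (-z^{-2})^{L(0)} u, z^{-1}) a > *)
Lemma Y_WW'_V'E (u : dsum W) (f : dsum (contragredient W)) n (a : dsum V) :
  pairing (Y_WW'_V' u f n : dsum (gdual V)) a
  = pairing f (sbind (fun w => sinv (Y_WV_W w a)) (sconj 1 (@mL K V W 1) u) n).
Proof.
apply: adjointE => //.
- exact: mL_linear.
- by move=> k x; apply: mL_deg; lia.
- exact: mL1_deg0.
- exact: Y_WV_W_linearl.
- exact: Y_WV_W_linearr.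
- exact: Y_WV_W_deg.
Qed.

End Grading.

Section VoaModule.
Variables (K : numFieldType) (V : vertexData K).
Hypothesis hV : is_voa V.

Lemma adjoint_is_module : is_module (adjoint_module V).
Proof.
by case: hV => *; split.
Qed.

Lemma vL1_linear : linear (@vL K V 1).
Proof. exact: (mL_linear adjoint_is_module). Qed.
Lemma vL1_deg k x : homog k.+1 x -> homog k (@vL K V 1 x).
Proof. by apply: (mL_deg hV adjoint_is_module); lia. Qed.
Lemma vL1_deg0 x : homog 0 x -> @vL K V 1 x = 0.
Proof. exact: (mL1_deg0 hV adjoint_is_module). Qed.

(* < Y_{W'}(a,z) f, u > = < f, Y_W(e^{zL(1)} (-z^{-2})^{L(0)} a, z^{-1}) u > *)
Lemma contragredientE (W : moduleData V) a f n (u : dsum W) : is_module W ->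
  pairing (mY a (f : dsum (contragredient W)) n : dsum (gdual W)) u
  = pairing f (sbind (fun b => sinv (mY b u)) (sconj 1 (vL 1) a) n).
Proof.
move=> hW; apply: adjointE => //.
- exact: vL1_linear.
- exact: vL1_deg.
- exact: vL1_deg0.
- exact: (m_linearl hW).
- exact: (m_linearr hW).
- exact: (mY_deg hV hW).
Qed.

End VoaModule.

(* Main.v *)
(* On homogeneous vectors, every matrix coefficient < f, Y(a,z) b > of the
   operators involved is a monomial in z whose exponent is forced by the degrees,
   so two such series agree as soon as they agree at z = 1. There e^{zL(1)} and
   (-z^{-2})^{L(0)} become E = e^{L(1)} and s = (-1)^{L(0)}, contragredients and
   skew-symmetry are substitutions of E and s in one trilinear form, and the only
   relations needed are s s = 1 and E s E = s. Contracting r with x = (f, u) in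
   V' (+) W gives R x = (T u, - T^* f), and contracting the three legs of the
   Yang-Baxter expression with x, y, z gives
     < x, (R z)_m (R y) > + < y, R z .'_m R x > + < z, R x .'op_m R y >,
   which splits into the Rota-Baxter identity paired with the V'-part of x and
   conditions (a) and (b) paired with its W-part. *)

Require Import Defs.
From mathcomp Require Import all_boot all_order all_algebra.
From mathcomp Require Import complex zify ring reals.
From mathcomp Require Import boolp classical_sets functions fsbigop.
Import Order.TTheory GRing.Theory Num.Theory.
Set Implicit Arguments.
Unset Strict Implicit.
Unset Printing Implicit Defensive.
Local Open Scope classical_set_scope.
Local Open Scope ring_scope.

(** * Finitely supported sums *)

(** Sums over infinite index sets are read as finite-support sums, with value 0 otherwise, so no
    rearrangement is free. A series Y(a,z)b may well have infinitely many coefficients; only its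
    pairing with a vector of the restricted dual is a finite object. Operators are therefore
    compared through their forms, and finiteness always comes from degrees. The Jacobi identity
    enters through the degree of a mode. The passage to z = 1 loses nothing once the contracted
    vectors are homogeneous, of degrees p, q, s: the inversions z^{-1} in the two primed products
    make all three terms live at the same exponent p - q - s, which is also that of the Rota-Baxter
    side. At z = 1 each side has nine terms, and they match one by one. The relation E s E = s comes
    from s L(1) s = -L(1). Skew-symmetry contains e^{zL(-1)}, which has no value at z = 1 by itself;
    it crosses the pairing as e^{zL(1)}, and the adjointness of L(-1) and L(1) rests on L(1) omega =
    0. *)

Section FiniteSupport.
Variables (K : fieldType) (I : choiceType).

(** A sum over an infinite support is 0 by convention, so additivity and exchange of sums need this
    condition. The bounding list may repeat entries, so concatenation suffices for a sum of two
    families. *)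
Definition fsupp (M : lmodType K) (F : I -> M) : Prop :=
  exists r : seq I, forall i, i \notin r -> F i = 0.

Definition fsum (M : lmodType K) (F : I -> M) : M := \sum_(i \in [set: I]) F i.

Lemma fsumE (M : lmodType K) (r : seq I) (F : I -> M) :
  (forall i, i \notin r -> F i = 0) ->
  fsum F = \sum_(i <- undup r) F i.
Proof.
move=> h; apply: fs_finite; first exact: undup_uniq.
by move=> i; rewrite mem_undup; apply: h.
Qed.

Variable M : lmodType K.
Implicit Types F G : I -> M.

Lemma eq_fsupp F G : F =1 G -> fsupp F -> fsupp G.
Proof. by move=> e [r h]; exists r => i /h; rewrite e. Qed.

Lemma eq_fsum F G : F =1 G -> fsum F = fsum G.
Proof. by move=> /funext ->. Qed.

Lemma fsupp0 : fsupp (fun _ => 0 : M).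
Proof. by exists [::]. Qed.

Lemma fsuppD F G : fsupp F -> fsupp G -> fsupp (fun i => F i + G i).
Proof.
move=> [r h] [s k]; exists (r ++ s) => i; rewrite mem_cat negb_or.
by move=> /andP[/h -> /k ->]; rewrite addr0.
Qed.

Lemma fsupp_lin (N : lmodType K) (f : M -> N) F :
  linear f -> fsupp F -> fsupp (fun i => f (F i)).
Proof. by move=> lf [r h]; exists r => i /h ->; apply: lin0. Qed.

Lemma fsum_lin (N : lmodType K) (f : M -> N) F :
  linear f -> fsupp F -> f (fsum F) = fsum (fun i => f (F i)).
Proof.
move=> lf [r h]; rewrite (fsumE h) (lin_sum lf) (fsumE (r := r)) // => i /h ->.
exact: lin0.
Qed.

Lemma scale_lin (c : K) : linear (fun x : M => c *: x).
Proof. by move=> d x y; rewrite scalerDr !scalerA mulrC. Qed.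

Lemma fsumZ c F : fsupp F -> fsum (fun i => c *: F i) = c *: fsum F.
Proof. by move=> h; rewrite (fsum_lin (scale_lin c) h). Qed.

Lemma fsuppZ c F : fsupp F -> fsupp (fun i => c *: F i).
Proof. exact: fsupp_lin (scale_lin c). Qed.

Lemma fsumD F G : fsupp F -> fsupp G ->
  fsum (fun i => F i + G i) = fsum F + fsum G.
Proof.
move=> [r h] [s k]; rewrite !(fsumE (r := r ++ s)) -?big_split //.
all: by move=> i; rewrite mem_cat negb_or => /andP[hi ki]; rewrite ?h ?k ?addr0.
Qed.

Lemma fsuppB F G : fsupp F -> fsupp G -> fsupp (fun i => F i - G i).
Proof.
move=> hF hG; apply: eq_fsupp (fsuppD hF (fsuppZ (-1) hG)) => i.
by rewrite scaleN1r.
Qed.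

Lemma fsumB F G : fsupp F -> fsupp G ->
  fsum (fun i => F i - G i) = fsum F - fsum G.
Proof.
move=> hF hG; rewrite -[- fsum G]scaleN1r -fsumZ // -fsumD //; last exact: fsuppZ.
by apply: eq_fsum => i; rewrite scaleN1r.
Qed.

Lemma fsupp_sum (J : Type) (t : seq J) (F : J -> I -> M) :
  (forall j, fsupp (F j)) -> fsupp (fun i => \sum_(j <- t) F j i).
Proof.
move=> h; elim: t => [|j t IH].
  by apply: eq_fsupp fsupp0 => i; rewrite big_nil.
by apply: eq_fsupp (fsuppD (h j) IH) => i; rewrite big_cons.
Qed.

Lemma fsum_sum (J : Type) (t : seq J) (F : J -> I -> M) :
  (forall j, fsupp (F j)) ->
  fsum (fun i => \sum_(j <- t) F j i) = \sum_(j <- t) fsum (F j).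
Proof.
move=> h; elim: t => [|j t IH].
  by rewrite big_nil (fsumE (r := [::])) ?big_nil // => i _; rewrite big_nil.
rewrite big_cons -IH -fsumD //; last exact: fsupp_sum.
by apply: eq_fsum => i; rewrite big_cons.
Qed.

Lemma fsum_single N F : (forall i, i <> N -> F i = 0) -> fsum F = F N.
Proof.
move=> h; rewrite (fsumE (r := [:: N])) /= ?big_seq1 // => i.
by rewrite inE => /eqP/h.
Qed.

(* A series with at most one nonzero coefficient, at a known index, is
   determined by its value at z = 1. *)
Lemma fsum_inj N F G : (forall i, i <> N -> F i = 0) ->
  (forall i, i <> N -> G i = 0) -> fsum F = fsum G -> F =1 G.
Proof.
move=> hF hG; rewrite (fsum_single hF) (fsum_single hG) => e i.
by have [->//|/eqP iN] := eqVneq i N; rewrite hF ?hG.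
Qed.

End FiniteSupport.

Section Shift.
Variables (K : fieldType) (M : lmodType K).
Implicit Type F : int -> M.

(** Multiplying by z^k, like replacing z by z^{-1} in [fsum_opp], only permutes the coefficients and
    is invisible at z = 1. *)
Lemma fsum_shift (k : int) F : fsum (fun n => F (n - k)) = fsum F.
Proof.
rewrite /fsum [RHS](reindex_fsbigT (fun n => n - k)) //.
by exists (fun n => n + k) => n; rewrite ?subrK ?addrK.
Qed.

Lemma fsum_opp F : fsum (fun n => F (- n)) = fsum F.
Proof.
by rewrite /fsum [RHS](reindex_fsbigT (fun n : int => - n)).
Qed.

Lemma fsupp_shift (k : int) F : fsupp F -> fsupp (fun n => F (n - k)).
Proof.
move=> [r h]; exists [seq n + k | n <- r] => n nr; apply: h.
by apply: contra nr => nr; apply/mapP; exists (n - k); rewrite ?subrK.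
Qed.

Lemma fsupp_opp F : fsupp F -> fsupp (fun n => F (- n)).
Proof.
move=> [r h]; exists [seq - n | n <- r] => n nr; apply: h.
by apply: contra nr => nr; apply/mapP; exists (- n); rewrite ?opprK.
Qed.

End Shift.

(** * Graded spaces and graded products *)

Section Homogeneous.
Variables (K : fieldType) (G : nat -> vectType K).
Implicit Types x y : dsum G.

(** Integer degrees let d + e + n be written without truncation; a negative degree is allowed and
    forces the vector to be 0. *)
Definition homogz (d : int) x : Prop := forall n : nat, n%:Z <> d -> x n = 0.

Lemma homogz0 d : homogz d (0 : dsum G).
Proof. by []. Qed.

Lemma homogzD d x y : homogz d x -> homogz d y -> homogz d (x + y).
Proof. by move=> hx hy n nd; rewrite /= hx ?hy ?addr0. Qed.

Lemma homogzZ d c x : homogz d x -> homogz d (c *: x).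
Proof. by move=> hx n nd; rewrite /= hx ?scaler0. Qed.

Lemma homogzN d x : homogz d x -> homogz d (- x).
Proof. by move=> hx n nd; rewrite /= hx ?oppr0. Qed.

Lemma homogzB d x y : homogz d x -> homogz d y -> homogz d (x - y).
Proof. by move=> hx /homogzN; apply: homogzD. Qed.

Lemma homogz_nat p x : homogz p%:Z x <-> homog p x.
Proof. by split=> h n np; apply: h => e; apply: np; [case: e|rewrite e]. Qed.

Lemma homogz_cases d x : homogz d x -> x = 0 \/ exists2 p : nat, d = p%:Z & homog p x.
Proof.
move=> h; have [d0|d0] := leP 0 d.
  right; exists (absz d); first by rewrite gez0_abs.
  by apply/homogz_nat; rewrite gez0_abs.
by left; apply: dsumP => n; apply: h => e; rewrite -e in d0.
Qed.

Lemma homogz_neg d x : d < 0 -> homogz d x -> x = 0.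
Proof. by move=> d0 /homogz_cases[//|[p e _]]; rewrite e in d0. Qed.

Lemma dinj_homogz k (v : G k) : homogz k%:Z (dinj v).
Proof. exact/homogz_nat/dinj_homog. Qed.

(** No clause for 0 is needed, as 0 is homogeneous of degree 0. *)
Lemma dsum_ind (Q : dsum G -> Prop) :
  (forall x y, Q x -> Q y -> Q (x + y)) ->
  (forall p x, homogz p%:Z x -> Q x) -> forall x, Q x.
Proof.
move=> QD Qh x; have [N h] := dsum_fin x; rewrite (dsum_decomp h).
apply: big_ind => //; first by apply: (Qh 0%N); apply: homogz0.
by move=> k _; apply: (Qh k); apply: dinj_homogz.
Qed.

Lemma homogz_fsb (I : choiceType) (D : set I) (F : I -> dsum G) d :
  (forall i, homogz d (F i)) -> homogz d (\sum_(i \in D) F i).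
Proof. by move=> h; apply: (@fs_ind I _ (homogz d)) => //; apply: homogzD. Qed.

Fact sgn_subproof x : exists N, forall n, (N <= n)%N -> (-1) ^+ n *: x n = 0.
Proof. by have [N h] := dsum_fin x; exists N => n /h ->; apply: scaler0. Qed.
(* (-1)^{L(0)} *)
Definition sgn x : dsum G := Dsum (sgn_subproof x).

Lemma sgn_linear : linear sgn.
Proof. by move=> c x y; apply: dsumP => n /=; apply: (@scale_lin K (G n)). Qed.

Lemma sgnK x : sgn (sgn x) = x.
Proof. by apply: dsumP => n; rewrite /= scalerA -expr2 sqrr_sign scale1r. Qed.

Lemma sgn_homog (p : nat) x : homogz p%:Z x -> sgn x = (-1) ^+ p *: x.
Proof.
move=> h; apply: dsumP => n /=; have [->//|/eqP np] := eqVneq n p.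
by rewrite h ?scaler0 // => -[].
Qed.

End Homogeneous.

Section LinearMaps.
Variables (K : fieldType) (A B C : lmodType K).

Lemma linear_comp (f : B -> C) (g : A -> B) :
  linear f -> linear g -> linear (fun x => f (g x)).
Proof. by move=> lf lg c x y; rewrite lg lf. Qed.

Lemma linear_add (f g : A -> B) : linear f -> linear g -> linear (fun x => f x + g x).
Proof. by move=> lf lg c x y; rewrite lf lg scalerDr addrACA. Qed.

Lemma linear_opp (f : A -> B) : linear f -> linear (fun x => - f x).
Proof. by move=> lf c x y; rewrite lf opprD scalerN. Qed.

Lemma linear_iter (f : A -> A) j : linear f -> linear (iter j f).
Proof. by move=> lf; elim: j => [|j IH] // c x y /=; rewrite IH lf. Qed.

Lemma linN (f : A -> B) x : linear f -> f (- x) = - f x.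
Proof. by move=> lf; rewrite -[in LHS]scaleN1r (linZ lf) scaleN1r. Qed.

Lemma linB (f : A -> B) x y : linear f -> f (x - y) = f x - f y.
Proof. by move=> lf; rewrite (linD lf) linN. Qed.

Lemma fsum_linear (I : choiceType) (F : A -> I -> B) :
  (forall i, linear (F^~ i)) -> (forall x, fsupp (F x)) ->
  linear (fun x => fsum (F x)).
Proof.
move=> lF hF c x y; rewrite -fsumZ // -fsumD //; last exact: fsuppZ.
by apply: eq_fsum => i; apply: lF.
Qed.

End LinearMaps.

Lemma vect_sep (K : fieldType) (E : vectType K) (x : E) :
  (forall phi : 'Hom(E, K^o), phi x = 0) -> x = 0.
Proof.
move=> h; rewrite (coord_vbasis (memvf x)) big1 // => i _.
by rewrite -dual_vecE h scale0r.
Qed.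

Section Graded.
Variable K : fieldType.
Implicit Types A B C D G H : nat -> vectType K.

Record shifts A B (k : int) (L : dsum A -> dsum B) : Prop := Shifts {
  shifts_linear : linear L;
  shifts_homogz : forall d x, homogz d x -> homogz (d + k) (L x) }.

(** The index [n] is the exponent of z: the mode a_m sits at n = -m-1, and the last clause says that
    it has degree deg a - m - 1. *)
Record graded_product A B C (Y : dsum A -> dsum B -> fser (dsum C)) : Prop :=
  GradedProduct {
  gp_linl : forall b n, linear (fun a => Y a b n);
  gp_linr : forall a n, linear (fun b => Y a b n);
  gp_homogz : forall d e n a b,
    homogz d a -> homogz e b -> homogz (d + e + n) (Y a b n) }.

Record graded_pairing D C (P : dsum D -> dsum C -> K^o) : Prop := GradedPairing {
  gpair_linl : forall x, linear (P^~ x);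
  gpair_linr : forall f, linear (P f);
  gpair_orth : forall d e f x, homogz d f -> homogz e x -> d <> e -> P f x = 0 }.

(* < f, Y(a,z) b > at z = 1: the sum is finite by grading *)
Definition form A B C D (P : dsum D -> dsum C -> K^o)
    (Y : dsum A -> dsum B -> fser (dsum C)) f a b : K^o :=
  fsum (fun n => P f (Y a b n)).

Lemma iter_shifts A (k : int) (L : dsum A -> dsum A) j : shifts k L ->
  shifts (k *+ j) (iter j L).
Proof.
move=> [lL hL]; split; first exact: linear_iter.
move=> d x hx; elim: j => [|j IH] /=; first by rewrite mulr0n addr0.
by rewrite mulrSr addrA; apply: hL.
Qed.

(** On degree p, more than p applications of [L] would reach a negative degree. *)
Lemma lowering_nilp A (L : dsum A -> dsum A) x : shifts (-1) L ->
  exists N, forall j, (N <= j)%N -> iter j L x = 0.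
Proof.
move=> hL; elim/dsum_ind: x => [x y [N hx] [M hy]|p x hx].
  exists (maxn N M) => j; rewrite geq_max => /andP[Nj Mj].
  by rewrite (linD (linear_iter j (shifts_linear hL))) hx ?hy ?addr0.
exists p.+1 => j pj; apply: (homogz_neg _ (shifts_homogz (iter_shifts j hL) hx)).
by rewrite mulNrn; lia.
Qed.

(** For homogeneous arguments of degrees r, p, q only the exponent n = r - p - q can contribute. *)
Lemma gpair_form_supp A B C D (P : dsum D -> dsum C -> K^o)
    (Y : dsum A -> dsum B -> fser (dsum C)) f a b :
  graded_pairing P -> graded_product Y -> fsupp (fun n => P f (Y a b n)).
Proof.
move=> hP hY; elim/dsum_ind: f => [f g hf hg|r f hf].
  by apply: eq_fsupp (fsuppD hf hg) => n; rewrite (linD (gpair_linl hP _)).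
elim/dsum_ind: a => [x y hx hy|p a ha].
  apply: eq_fsupp (fsuppD hx hy) => n.
  by rewrite (linD (gp_linl hY _ _)) (linD (gpair_linr hP _)).
elim/dsum_ind: b => [x y hx hy|q b hb].
  apply: eq_fsupp (fsuppD hx hy) => n.
  by rewrite (linD (gp_linr hY _ _)) (linD (gpair_linr hP _)).
exists [:: r%:Z - p%:Z - q%:Z] => n; rewrite inE => /eqP nr.
by apply: (gpair_orth hP hf (gp_homogz hY ha hb)) => e; apply: nr; rewrite e; lia.
Qed.

Section Forms.
Variables (A B C D : nat -> vectType K) (P : dsum D -> dsum C -> K^o).
Variable Y : dsum A -> dsum B -> fser (dsum C).
Hypotheses (hP : graded_pairing P) (hY : graded_product Y).

Lemma form_linf a b : linear (fun f => form P Y f a b).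
Proof.
apply: fsum_linear => [n|f]; first exact: gpair_linl.
exact: gpair_form_supp hP hY.
Qed.

(** Conjugation by (-1)^{L(0)} is the substitution z -> -z, because the coefficient of z^n shifts
    total degree by n. *)
Lemma sgn_product a b n : sgn (Y (sgn a) (sgn b) n) = (-1) ^ n *: Y a b n.
Proof.
elim/dsum_ind: a => [x y hx hy|p a ha].
  rewrite (linD (@sgn_linear _ _)) !(linD (gp_linl hY _ _)).
  by rewrite (linD (@sgn_linear _ _)) scalerDr hx hy.
elim/dsum_ind: b => [x y hx hy|q b hb].
  rewrite (linD (@sgn_linear _ _)) !(linD (gp_linr hY _ _)).
  by rewrite (linD (@sgn_linear _ _)) scalerDr hx hy.
rewrite (sgn_homog ha) (sgn_homog hb) (linZ (gp_linl hY _ _)) (linZ (gp_linr hY _ _)).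
rewrite !(linZ (@sgn_linear _ _)) !scalerA.
have [->|[k e hk]] := homogz_cases (gp_homogz hY ha hb (n := n)).
  by rewrite (lin0 (@sgn_linear _ _)) !scaler0.
rewrite (sgn_homog ((homogz_nat _ _).2 hk)) scalerA.
congr (_ *: _); rewrite (_ : n = k%:Z - p%:Z - q%:Z); last by rewrite -e; lia.
have h j : (-1 : K) ^ (- j%:Z) = (-1) ^+ j.
  by rewrite -invr_expz -exprnP invr_sign.
by rewrite !expfzDr ?oppr_eq0 ?oner_eq0 // !h -exprnP mulrC mulrA.
Qed.

Hypothesis P_sgn : forall f x, P (sgn f) x = P f (sgn x).

Lemma fsum_sneg f a b :
  fsum (fun n => P f (sneg (Y a b) n)) = form P Y (sgn f) (sgn a) (sgn b).
Proof. by apply: eq_fsum => n; rewrite P_sgn sgn_product. Qed.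

End Forms.
End Graded.

(** * Exponentials of lowering operators *)

Section Exponential.
Variable K : numFieldType.
Implicit Types G : nat -> vectType K.

(* e^{c L} *)
Definition expL G (c : K) (L : dsum G -> dsum G) (x : dsum G) : dsum G :=
  fsum (fun j : nat => (c ^+ j / j`!%:R) *: iter j L x).

Section Lowering.
Variables (G : nat -> vectType K) (L : dsum G -> dsum G).
Hypothesis hL : shifts (-1) L.

Lemma expLE c N x : (forall j, (N <= j)%N -> iter j L x = 0) ->
  expL c L x = \sum_(0 <= j < N) (c ^+ j / j`!%:R) *: iter j L x.
Proof.
move=> hN; apply: fs_finite; first exact: iota_uniq.
by move=> j; rewrite mem_index_iota /= -leqNgt => /hN ->; rewrite scaler0.
Qed.

Lemma expL_supp c x : fsupp (fun j : nat => (c ^+ j / j`!%:R) *: iter j L x).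
Proof.
have [N hN] := lowering_nilp x hL; exists (iota 0 N) => j.
by rewrite mem_iota /= -leqNgt => /hN ->; rewrite scaler0.
Qed.

Lemma expL_linear c : linear (expL c L).
Proof.
apply: fsum_linear => [j|]; last exact: expL_supp.
exact: linear_comp (@scale_lin _ _ _) (linear_iter j (shifts_linear hL)).
Qed.

Lemma expLD c d x : expL c L (expL d L x) = expL (c + d) L x.
Proof.
have [N hN] := lowering_nilp x hL.
have lL j := linear_iter j (shifts_linear hL).
have hN' i j : (N <= i + j)%N -> iter i L (iter j L x) = 0.
  by move=> h; rewrite -iterD hN.
rewrite (expLE d hN) (lin_sum (expL_linear c)).
under eq_bigr => j _.
  rewrite (linZ (expL_linear c)) (@expLE c N (iter j L x)); last first.
    by move=> i Ni; apply: hN'; lia.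
  rewrite scaler_sumr.
  under eq_bigr do rewrite -iterD scalerA.
  over.
rewrite (expLE (c + d) hN) /=.
(* [g] extends the triangle i <= n by zero to a square, so that the sums can be exchanged: for fixed
   n the binomial theorem gives (c + d)^n / n!, while j = n - i recovers the product of the two
   exponentials. *)
pose g i n : dsum G := if (i <= n)%N then
  (d ^+ i / i`!%:R * (c ^+ (n - i) / (n - i)`!%:R)) *: iter n L x else 0.
transitivity (\sum_(0 <= n < N) \sum_(0 <= i < N) g i n); last first.
  apply: eq_big_nat => n /andP[_ nN].
  transitivity (\sum_(0 <= i < n.+1) g i n).
    rewrite [LHS](@big_cat_nat _ _ _ n.+1) //= [X in _ + X]big1_seq ?addr0 //.
    by move=> i; rewrite mem_index_iota /g => /andP[_ /andP[ni _]]; rewrite leqNgt ni.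
  rewrite big_nat; under eq_bigr => i /andP[_ i_n] do rewrite /g -ltnS i_n.
  rewrite -big_nat -scaler_suml; congr (_ *: _).
  rewrite exprDn mulr_suml big_mkord; apply: eq_bigr => -[i /= i_n] _.
  have f0 j : (j`!%:R : K) != 0 by rewrite pnatr_eq0 -lt0n fact_gt0.
  have b0 : ('C(n, i)%:R : K) != 0 by rewrite pnatr_eq0 -lt0n bin_gt0.
  rewrite -mulr_natr -(bin_fact (n := n) (m := i) i_n) !natrM.
  by field; rewrite b0 !f0.
rewrite [RHS]exchange_big /=; apply: eq_big_nat => i /andP[_ iN].
transitivity (\sum_(i <= n < N) g i n); last first.
  rewrite [RHS](@big_cat_nat _ _ _ i) ?(ltnW iN) //= [X in X + _]big1_seq ?add0r //.
  by move=> n; rewrite mem_index_iota /g => /andP[_ /andP[_ ni]]; rewrite leqNgt ni.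
have -> : \sum_(i <= n < N) g i n = \sum_(0 <= j < N - i) g i (j + i)%N.
  by rewrite -[X in \sum_(X <= _ < _) _](add0n i) big_addn.
(* The inner exponential was cut at N rather than N - i; its extra terms contain L^{i+j} x with i +
   j >= N. *)
rewrite [LHS](@big_cat_nat _ _ _ (N - i)) ?leq_subr //=.
rewrite [X in _ + X]big1_seq ?addr0 => [|j]; last first.
  by rewrite mem_index_iota => /andP[_ /andP[h _]]; rewrite hN ?scaler0 //; lia.
by apply: eq_bigr => j _; rewrite /g leq_addl addnK.
Qed.

Lemma expL0 x : expL 0 L x = x.
Proof.
rewrite /expL (fsum_single (N := 0%N)) => [|[|j] // _].
  by rewrite expr0 fact0 divr1 scale1r.
by rewrite expr0n mul0r scale0r.
Qed.

(** Lowering the degree by one means anticommuting with (-1)^{L(0)}, so each factor [L] contributes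
    a sign. *)
Lemma iter_sgn j x : sgn (iter j L (sgn x)) = (-1) ^+ j *: iter j L x.
Proof.
elim/dsum_ind: x => [x y hx hy|p x hx].
  rewrite !(linD (@sgn_linear _ _)) (linD (linear_iter j (shifts_linear hL))).
  rewrite (linD (@sgn_linear _ _)) hx hy -scalerDr.
  by rewrite (linD (linear_iter j (shifts_linear hL))).
rewrite (sgn_homog hx) (linZ (linear_iter j (shifts_linear hL))).
rewrite (linZ (@sgn_linear _ _)).
have h := shifts_homogz (iter_shifts j hL) hx.
have [->|[k e hk]] := homogz_cases h; first by rewrite (lin0 (@sgn_linear _ _)) !scaler0.
rewrite (sgn_homog ((homogz_nat _ _).2 hk)) scalerA -exprD; congr (_ *: _).
have -> : p = (k + j)%N by move: e; rewrite mulNrn; lia.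
by rewrite addnAC exprD addnn -mul2n exprM sqrrN !expr1n mul1r.
Qed.

Lemma sgn_expL c x : sgn (expL c L (sgn x)) = expL (- c) L x.
Proof.
rewrite /expL (fsum_lin (@sgn_linear _ _)); last exact: expL_supp.
apply: eq_fsum => j; rewrite (linZ (@sgn_linear _ _)) iter_sgn scalerA.
by rewrite mulrAC -exprMn mulrN1.
Qed.

(** With E_c = e^{cL} and s E_c s = E_{-c}, one has E_1 s E_1 = s (s E_1 s) E_1 = s E_{-1} E_1 =
    s. *)
Lemma expL_sgn_expL x : expL 1 L (sgn (expL 1 L x)) = sgn x.
Proof. by rewrite -[LHS]sgnK sgn_expL expLD addNr expL0. Qed.

(** A bound uniform in n turns the exponential into one fixed finite sum, which can then be
    exchanged with the sum over n. *)
Lemma sexp_bound (p : fser (dsum G)) : fsupp p ->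
  exists N, forall j n, (N <= j)%N -> iter j L (p n) = 0.
Proof.
move=> [r hr].
suff [N hN] : exists N, forall j n, n \in r -> (N <= j)%N -> iter j L (p n) = 0.
  exists N => j n Nj; have [nr|/hr ->] := boolP (n \in r); first exact: hN.
  exact: lin0 (linear_iter j (shifts_linear hL)).
elim: r {hr} => [|k r [N hN]]; first by exists 0%N.
have [M hM] := lowering_nilp (p k) hL; exists (maxn M N) => j n.
by rewrite inE geq_max => /orP[/eqP ->|nr] /andP[Mj Nj]; [apply: hM|apply: hN].
Qed.

Lemma sexp_fsum c (p : fser (dsum G)) : fsupp p ->
  fsupp (sexp c L p) /\ fsum (sexp c L p) = expL c L (fsum p).
Proof.
move=> hp; have [N hN] := sexp_bound hp.
have lL j := linear_iter j (shifts_linear hL).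
have hs j : fsupp (fun n => (c ^+ j / j`!%:R) *: iter j L (p (n - j%:Z))).
  apply/fsuppZ/(fsupp_lin (lL j)); exact: fsupp_shift.
have e : (fun n => \sum_(0 <= j < N) (c ^+ j / j`!%:R) *: iter j L (p (n - j%:Z)))
    =1 sexp c L p.
  move=> n; apply/esym/fs_finite; first exact: iota_uniq.
  by move=> j; rewrite mem_index_iota /= -leqNgt => /hN ->; rewrite scaler0.
split; first by apply: eq_fsupp e _; apply: fsupp_sum.
rewrite -(eq_fsum e) fsum_sum //.
rewrite (@expLE c N (fsum p)) => [|j Nj]; last first.
  rewrite (fsum_lin (lL j) hp) (fsumE (r := [::])) ?big_nil // => n _; exact: hN.
apply: eq_bigr => j _; rewrite fsumZ; last by apply/(fsupp_lin (lL j))/fsupp_shift.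
by rewrite -(fsum_lin (lL j)) ?fsum_shift //; apply: fsupp_shift.
Qed.

Lemma sexp_linear (B : lmodType K) c (p : B -> fser (dsum G)) n :
  (forall k, linear (p^~ k)) -> (forall x, fsupp (p x)) ->
  linear (fun x => sexp c L (p x) n).
Proof.
move=> lp hp; apply: fsum_linear => [j|x].
  apply: linear_comp (@scale_lin _ _ _) _.
  exact: linear_comp (linear_iter j (shifts_linear hL)) (lp _).
have [N hN] := sexp_bound (hp x); exists (iota 0 N) => j.
by rewrite mem_iota /= -leqNgt => /hN ->; rewrite scaler0.
Qed.

(** Here z counts with degree +1, against -1 in [graded_product]: these series are inserted into
    products evaluated at z^{-1}. *)
Lemma sexp_lower_homogz c d (p : fser (dsum G)) :
  (forall n, homogz (d - n) (p n)) -> forall n, homogz (d - n) (sexp c L p n).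
Proof.
move=> hp n; apply: homogz_fsb => j; apply: homogzZ.
have := shifts_homogz (iter_shifts j hL) (hp (n - j%:Z)); congr homogz.
by rewrite mulNrn; lia.
Qed.

End Lowering.

Section Conjugation.
Variable G : nat -> vectType K.

Lemma scst_fsum (x : dsum G) : fsupp (scst x) /\ fsum (scst x) = x.
Proof.
have h i : i <> 0 -> scst x i = 0 by rewrite /scst; case: eqP.
split; last by rewrite (fsum_single h).
by exists [:: 0] => i; rewrite inE => /eqP/h.
Qed.

Lemma scst_homogz d (x : dsum G) : homogz d x -> forall n, homogz (d - n) (scst x n).
Proof. by move=> hx n; rewrite /scst; case: eqP => // ->; rewrite subr0. Qed.

(** At most one k satisfies n = -2k; an indicator for each k gives a finite sum whose range does not
    depend on n. *)
Let szL0_term (a : dsum G) k (n : int) : dsum G :=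
  if n == - (k%:Z *+ 2) then (-1) ^+ k *: dinj (a k) else 0.

Let szL0E (a : dsum G) N n : (forall k, (N <= k)%N -> a k = 0) ->
  szL0 a n = \sum_(k <- iota 0 N) szL0_term a k n.
Proof.
move=> hN; rewrite /szL0 fsbig_mkcond.
rewrite (@fs_finite _ _ (iota 0 N)) ?iota_uniq //; last first.
  move=> k; rewrite mem_iota /= -leqNgt => /hN ak.
  by rewrite /patch; case: ifP => // _; rewrite ak (lin0 (@dinj_linear _ _ k)) scaler0.
apply: eq_bigr => k _; rewrite /patch /szL0_term.
by case: eqP => h; [rewrite mem_set|rewrite memNset].
Qed.

Lemma szL0_linear n : linear (fun a : dsum G => szL0 a n).
Proof.
move=> c a b; have [N hN] := dsum_fin a; have [M hM] := dsum_fin b.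
rewrite !(@szL0E _ (maxn N M)); last first.
- by move=> k; rewrite geq_max /= => /andP[/hN -> /hM ->]; rewrite scaler0 addr0.
- by move=> k; rewrite geq_max => /andP[/hN].
- by move=> k; rewrite geq_max => /andP[_ /hM].
rewrite scaler_sumr -big_split; apply: eq_bigr => k _; rewrite /szL0_term /=.
case: eqP => _; last by rewrite scaler0 addr0.
by rewrite (@dinj_linear _ _ k) (@scale_lin _ _ _ c).
Qed.

Lemma szL0_homog p (a : dsum G) n : homogz p%:Z a ->
  szL0 a n = if n == - (p%:Z *+ 2) then (-1) ^+ p *: a else 0.
Proof.
move=> ha; have a0 k : k <> p -> a k = 0 by move=> kp; apply: ha => -[].
rewrite (@szL0E _ p.+1) => [|k pk]; last by apply: a0 => kp; rewrite kp ltnn in pk.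
rewrite -[p.+1]addn1 iotaD big_cat big_seq1 big_seq big1 => [|k] /=.
  rewrite add0r /szL0_term add0n (_ : dinj (a p) = a) //.
  apply: dsumP => k; have [->|/eqP kp] := eqVneq k p; first exact: dinjE.
  by rewrite (dinj_homog _ kp) a0.
rewrite mem_iota /= /szL0_term => kp; rewrite a0 => [|e]; last by rewrite e ltnn in kp.
by rewrite (lin0 (@dinj_linear _ _ k)) scaler0 if_same.
Qed.

Lemma szL0_fsum (a : dsum G) : fsupp (szL0 a) /\ fsum (szL0 a) = sgn a.
Proof.
have [N hN] := dsum_fin a; pose F := szL0_term a.
have e : (fun n => \sum_(k <- iota 0 N) F k n) =1 szL0 a.
  by move=> n; rewrite (szL0E n hN).
have s k : fsupp (F k).
  by exists [:: - (k%:Z *+ 2)] => n; rewrite inE /F /szL0_term => /negPf ->.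
split; first by apply: eq_fsupp e _; apply: fsupp_sum.
rewrite -(eq_fsum e) fsum_sum // (@dsum_decomp _ _ (sgn a) N); last first.
  by move=> n /hN /= ->; apply: scaler0.
apply: eq_bigr => k _; rewrite (fsum_single (N := - (k%:Z *+ 2))) /F /szL0_term ?eqxx.
  by rewrite (linZ (@dinj_linear _ _ k)).
by move=> i /eqP/negPf ->.
Qed.

Lemma szL0_homogz d (a : dsum G) : homogz d a -> forall n, homogz (- d - n) (szL0 a n).
Proof.
move=> ha n k kd; have [N hN] := dsum_fin a.
rewrite (szL0E n hN) dsum_sumE big1 // => j _; rewrite /szL0_term.
case: eqP => // nj; have [e|/eqP jd] := eqVneq j%:Z d.
  by rewrite /= dfwith_out ?scaler0 //; apply/eqP => jk; apply: kd; rewrite -jk; lia.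
by rewrite ha // (lin0 (@dinj_linear _ _ j)) scaler0.
Qed.

Variable L : dsum G -> dsum G.
Hypothesis hL : shifts (-1) L.

Lemma sconj_fsum c a : fsupp (sconj c L a) /\ fsum (sconj c L a) = expL c L (sgn a).
Proof. by have [h <-] := szL0_fsum a; exact: (sexp_fsum hL c h). Qed.

Lemma sconj_linear c n : linear (fun a => sconj c L a n).
Proof.
apply: (sexp_linear hL) => [k|a]; first exact: szL0_linear.
exact: (szL0_fsum a).1.
Qed.

Lemma sconj_homogz c d a : homogz d a -> forall n, homogz (- d - n) (sconj c L a n).
Proof. by move=> /szL0_homogz; apply: (sexp_lower_homogz hL). Qed.

Lemma sexp_scst_fsum c x : fsupp (sexp c L (scst x)) /\
  fsum (sexp c L (scst x)) = expL c L x.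
Proof. by have [h {3}<-] := scst_fsum x; exact: (sexp_fsum hL c h). Qed.

Lemma sexp_scst_linear c n : linear (fun x => sexp c L (scst x) n).
Proof.
apply: (sexp_linear hL) => [k d x y|x]; last exact: (scst_fsum x).1.
by rewrite /scst; case: eqP => // _; rewrite scaler0 addr0.
Qed.

Lemma sexp_scst_homogz c d x : homogz d x ->
  forall n, homogz (d - n) (sexp c L (scst x) n).
Proof. by move=> /scst_homogz; apply: (sexp_lower_homogz hL). Qed.

End Conjugation.
End Exponential.

(** * Contragredients and skew-symmetry at z = 1 *)

Section Substitution.
Variables (K : fieldType) (M N : lmodType K).
Variables (phi : N -> K^o) (F : M -> fser N) (A : fser M).
Hypotheses (phi_linear : linear phi) (hA : fsupp A).
Hypothesis F_linear : forall n, linear (F^~ n).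
Hypothesis F_supp : forall x, fsupp (fun n => phi (F x n)).

(** The functional [phi] makes the series finite. At z = 1 the shift of exponents by k disappears,
    so by linearity F is applied to A(1). *)
Lemma sbind_fsum : fsupp (fun n => phi (sbind F A n)) /\
  fsum (fun n => phi (sbind F A n)) = fsum (fun n => phi (F (fsum A) n)).
Proof.
have [r hr] := hA; set t := undup r.
have e : (fun n => \sum_(k <- t) phi (F (A k) (n - k))) =1
    (fun n => phi (sbind F A n)).
  move=> n; rewrite -(lin_sum phi_linear); congr phi; apply/esym.
  rewrite /sbind -/(fsum _) (fsumE (r := r)) // => k /hr ->.
  exact: (lin0 (F_linear _)).
have s k : fsupp (fun n => phi (F (A k) (n - k))).
  exact: (fsupp_shift k (F_supp (A k))).
split; first by apply: eq_fsupp e _; apply: fsupp_sum.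
rewrite -(eq_fsum e) fsum_sum // (fsumE hr).
rewrite -[RHS](@eq_fsum _ _ _ (fun n => \sum_(k <- t) phi (F (A k) n))) => [|n].
  rewrite fsum_sum //; apply: eq_bigr => k _.
  by rewrite (fsum_shift k (fun n => phi (F (A k) n))).
by rewrite (lin_sum (F_linear n)) (lin_sum phi_linear).
Qed.

End Substitution.

Lemma sbind_linear (K : fieldType) (M N B : lmodType K) (F : B -> M -> fser N)
    (A : fser M) n : fsupp A ->
  (forall b n, linear (fun a => F b a n)) -> (forall a n, linear (fun b => F b a n)) ->
  linear (fun b => sbind (F b) A n).
Proof.
move=> hA lFa lFb; apply: fsum_linear => [k|b]; first exact: lFb.
by have [r hr] := hA; exists r => k /hr ->; apply: (lin0 (lFa _ _)).
Qed.

Lemma sbind_linear_arg (K : fieldType) (M N B : lmodType K) (F : M -> fser N)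
    (A : B -> fser M) n : (forall n, linear (F^~ n)) ->
  (forall b, fsupp (A b)) -> (forall n, linear (A^~ n)) ->
  linear (fun b => sbind F (A b) n).
Proof.
move=> lF hA lA; apply: fsum_linear => [k|b]; first exact: linear_comp (lF _) (lA k).
by have [r hr] := hA b; exists r => k /hr ->; apply: (lin0 (lF _)).
Qed.

Section Conjugates.
Variables (K : numFieldType) (A B C D : nat -> vectType K).
Variables (P : dsum D -> dsum C -> K^o) (Y : dsum A -> dsum B -> fser (dsum C)).
Variables (L : dsum A -> dsum A).
Hypotheses (hP : graded_pairing P) (hY : graded_product Y) (hL : shifts (-1) L).

(** With c = 1 this is the common core of [adjoint] and of [dot']. *)
Definition conj_prod c (a : dsum A) (b : dsum B) : fser (dsum C) :=
  sbind (fun a' => sinv (Y a' b)) (sconj c L a).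

Lemma conj_prod_fsum f c a b : fsupp (fun n => P f (conj_prod c a b n)) /\
  fsum (fun n => P f (conj_prod c a b n)) = form P Y f (expL c L (sgn a)) b.
Proof.
have [hA <-] := sconj_fsum hL c a.
have lY n : linear (fun a' => sinv (Y a' b) n) by exact: gp_linl.
have sY x : fsupp (fun n => P f (sinv (Y x b) n)).
  exact: fsupp_opp (gpair_form_supp f x b hP hY).
have [s e] := sbind_fsum (gpair_linr hP f) hA lY sY.
by split=> //; rewrite e (fsum_opp (fun n => P f (Y _ b n))).
Qed.

Lemma conj_prod_homogz c d e a b n : homogz d a -> homogz e b ->
  homogz (e - d - n) (conj_prod c a b n).
Proof.
move=> ha hb; apply: homogz_fsb => k.
have := gp_homogz hY (sconj_homogz hL c ha (n := k)) hb (n := - (n - k)).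
by congr homogz; lia.
Qed.

Lemma conj_prod_linr c a n : linear (fun b => conj_prod c a b n).
Proof.
apply: (@sbind_linear K _ _ _ (fun b a' => sinv (Y a' b))).
- exact: (sconj_fsum hL c a).1.
- by move=> b k; apply: gp_linl.
- by move=> a' k; apply: gp_linr.
Qed.

Lemma conj_prod_linl c b n : linear (fun a => conj_prod c a b n).
Proof.
apply: sbind_linear_arg => [k|a|k]; first exact: gp_linl.
  exact: (sconj_fsum hL c a).1.
exact: sconj_linear.
Qed.

Variable L' : dsum B -> dsum B.
Hypothesis hL' : shifts (-1) L'.
Hypothesis P_sgn : forall f x, P (sgn f) x = P f (sgn x).

(** The series whose coefficient [dot'op] extracts. *)
Definition op_prod (x : dsum B) (y : dsum A) : fser (dsum C) :=
  sbind (fun b => sbind (fun a => sneg (sinv (Y a b))) (sconj (-1) L y))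
    (sexp 1 L' (scst x)).

Let sneg_linl b n : linear (fun a => sneg (sinv (Y a b)) n).
Proof. exact: linear_comp (@scale_lin _ _ _) (gp_linl hY b (- n)). Qed.

Let sneg_linr a n : linear (fun b => sneg (sinv (Y a b)) n).
Proof. exact: linear_comp (@scale_lin _ _ _) (gp_linr hY a (- n)). Qed.

(** At z = 1 the argument -z^{-1} is -1, which puts s on all three entries; on the entry of y it
    meets e^{-L} s, and s e^{-L} s = e^{L}. *)
Lemma op_prod_fsum f x y : fsupp (fun n => P f (op_prod x y n)) /\
  fsum (fun n => P f (op_prod x y n))
    = form P Y (sgn f) (expL 1 L y) (sgn (expL 1 L' x)).
Proof.
have [hA eA] := sconj_fsum hL (-1) y.
have [hB eB] := sexp_scst_fsum hL' 1 x.
have e a b n : P f (sneg (sinv (Y a b)) n) = P (sgn f) (Y (sgn a) (sgn b) (- n)).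
  rewrite P_sgn (sgn_product hY) /sneg /sinv; congr (P f (_ *: _)).
  by rewrite -exprz_inv invrN1.
have sY b a : fsupp (fun n => P f (sneg (sinv (Y a b)) n)).
  apply: (@eq_fsupp _ _ _ (fun n => P (sgn f) (Y (sgn a) (sgn b) (- n)))) => [n|].
    by rewrite e.
  exact: fsupp_opp (gpair_form_supp _ _ _ hP hY).
have hS b := sbind_fsum (gpair_linr hP f) hA (sneg_linl b) (sY b).
have [s1 ->] := sbind_fsum (gpair_linr hP f) hB
  (fun n => sbind_linear n hA sneg_linl sneg_linr) (fun b => (hS b).1).
split=> //; rewrite (hS _).2 eA eB (eq_fsum (e _ _)).
rewrite (fsum_opp (fun n => P (sgn f) (Y _ _ n))) /form.
by rewrite (sgn_expL hL) opprK.
Qed.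

Lemma op_prod_linl y n : linear (fun x => op_prod x y n).
Proof.
apply: sbind_linear_arg => [k|x|k].
- exact: sbind_linear (sconj_fsum hL (-1) y).1 sneg_linl sneg_linr.
- exact: (sexp_scst_fsum hL' 1 x).1.
- exact: sexp_scst_linear.
Qed.

Lemma op_prod_linr x n : linear (op_prod x ^~ n).
Proof.
apply: fsum_linear => [k|y].
  apply: sbind_linear_arg => [j|y|j]; first exact: sneg_linl.
    exact: (sconj_fsum hL (-1) y).1.
  exact: sconj_linear.
have [r hr] := (sexp_scst_fsum hL' 1 x).1; exists r => k /hr ->.
exact: lin0 (sbind_linear _ (sconj_fsum hL (-1) y).1 sneg_linl sneg_linr).
Qed.

Lemma op_prod_homogz d e x y n : homogz d x -> homogz e y ->
  homogz (d - e - n) (op_prod x y n).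
Proof.
move=> hx hy; apply: homogz_fsb => k; apply: homogz_fsb => j.
apply: homogzZ; rewrite /sinv.
have := gp_homogz hY (sconj_homogz hL (-1) hy (n := j))
  (sexp_scst_homogz hL' 1 hx (n := k)) (n := - (n - k - j)).
by congr homogz; lia.
Qed.

End Conjugates.

Section SkewSymmetry.
Variables (K : numFieldType) (A B C D : nat -> vectType K).
Variables (Y : dsum A -> dsum B -> fser (dsum C)) (Lm1 : dsum C -> dsum C).
Hypotheses (hY : graded_product Y) (hLm1 : shifts 1 Lm1).

(** [Lm1] raises degrees and need not be nilpotent. The terms stop because the coefficient of
    Y(a,z)b at n - j has negative degree for large j. *)
Let skew_supp b a n : fsupp (fun j : nat =>
  ((1 : K) ^+ j / j`!%:R) *: iter j Lm1 (sneg (Y a b) (n - j%:Z))).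
Proof.
have lL j := linear_iter j (shifts_linear hLm1).
elim/dsum_ind: a => [x y hx hy|p a ha].
  apply: eq_fsupp (fsuppD hx hy) => j; rewrite /sneg.
  by rewrite (linD (gp_linl hY _ _)) scalerDr (linD (lL j)) scalerDr.
elim/dsum_ind: b => [x y hx hy|q b hb].
  apply: eq_fsupp (fsuppD hx hy) => j; rewrite /sneg.
  by rewrite (linD (gp_linr hY _ _)) scalerDr (linD (lL j)) scalerDr.
exists (iota 0 (absz (p%:Z + q%:Z + n)).+1) => j; rewrite mem_iota /= => hj.
rewrite /sneg (homogz_neg _ (gp_homogz hY ha hb)); last by lia.
by rewrite scaler0 (lin0 (lL j)) scaler0.
Qed.

Lemma skewsym_graded : graded_product (skewsym Lm1 Y).
Proof.
have lL j := linear_iter j (shifts_linear hLm1).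
split.
- move=> a n; apply: fsum_linear => [j|b]; last exact: skew_supp.
  apply: linear_comp (@scale_lin _ _ _) (linear_comp (lL j) _).
  exact: linear_comp (@scale_lin _ _ _) (gp_linr hY a _).
- move=> b n; apply: fsum_linear => [j|a]; last exact: skew_supp.
  apply: linear_comp (@scale_lin _ _ _) (linear_comp (lL j) _).
  exact: linear_comp (@scale_lin _ _ _) (gp_linl hY b _).
move=> d e n b a hb ha; apply: homogz_fsb => j; apply: homogzZ.
have := shifts_homogz (iter_shifts j hLm1)
  (homogzZ ((-1) ^ (n - j%:Z)) (gp_homogz hY ha hb (n := n - j%:Z))).
by congr homogz; lia.
Qed.

Variables (P : dsum D -> dsum C -> K^o) (Ls : dsum D -> dsum D).
Hypotheses (hP : graded_pairing P) (hLs : shifts (-1) Ls).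
Hypothesis P_sgn : forall f x, P (sgn f) x = P f (sgn x).
Hypothesis P_adj : forall f x, P f (Lm1 x) = P (Ls f) x.

(** Under the pairing the raising exponential becomes that of the lowering operator [Ls] acting on
    [f], which is finite; the argument -z then contributes one s per entry. *)
Lemma form_skewsym f b a :
  form P (skewsym Lm1 Y) f b a = form P Y (sgn (expL 1 Ls f)) (sgn a) (sgn b).
Proof.
have [N hN] := lowering_nilp f hLs.
have P_iter j g x : P g (iter j Lm1 x) = P (iter j Ls g) x.
  by elim: j g => // j IH g; rewrite /= P_adj IH -iterS iterSr.
pose G g := fun n => P g (sneg (Y a b) n).
have sG g : fsupp (G g).
  apply: (@eq_fsupp _ _ _ (fun n => P (sgn g) (Y (sgn a) (sgn b) n))) => [n|].
    by rewrite P_sgn (sgn_product hY).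
  exact: gpair_form_supp hP hY.
transitivity (fsum (G (expL 1 Ls f))); last exact: fsum_sneg.
rewrite (expLE 1 hN) /form.
(* Cutting at the nilpotency order of [Ls] on [f], the same for all n, is what allows the sums over
   j and n to be exchanged. *)
rewrite -(@eq_fsum _ _ _ (fun n => \sum_(0 <= j < N)
    ((1 : K) ^+ j / j`!%:R) *: G (iter j Ls f) (n - j%:Z))) => [|n]; last first.
  rewrite /skewsym /sexp -/(fsum _) (fsum_lin (gpair_linr hP f)) //.
  rewrite (fsumE (r := iota 0 N)) ?undup_id ?iota_uniq //.
    rewrite /index_iota subn0; apply: eq_bigr => j _.
    by rewrite (linZ (gpair_linr hP f)) P_iter.
  move=> j; rewrite mem_iota /= -leqNgt => Nj.
  by rewrite (linZ (gpair_linr hP f)) P_iter hN // (lin0 (gpair_linl hP _)) scaler0.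
rewrite fsum_sum => [|j]; last exact/fsuppZ/(fsupp_shift j%:Z (sG _)).
rewrite -[RHS](@eq_fsum _ _ _ (fun n => \sum_(0 <= j < N)
    ((1 : K) ^+ j / j`!%:R) *: G (iter j Ls f) n)) => [|n]; last first.
  rewrite /G (lin_sum (gpair_linl hP _)); apply: eq_bigr => j _.
  by rewrite (linZ (gpair_linl hP _)).
rewrite fsum_sum => [|j]; last exact: fsuppZ.
apply: eq_bigr => j _; rewrite !fsumZ ?fsum_shift //.
exact: (fsupp_shift j%:Z (sG _)).
Qed.

End SkewSymmetry.

(** * The pairing with the restricted dual *)

Section Pairing.
Variables (K : numFieldType) (G : nat -> vectType K).
Implicit Types (f g : dsum (gdual G)) (u : dsum G).

Lemma pairing_linl u : linear (fun f => pairing f u : K^o).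
Proof.
move=> c f g; have [N hN] := dsum_fin f; have [M hM] := dsum_fin g.
have h n : (maxn N M <= n)%N -> (c *: f + g) n = 0.
  by rewrite geq_max /= => /andP[/hN -> /hM ->]; rewrite scaler0 addr0.
rewrite (pairing_iota u h) !(pairing_iota (M := maxn N M)).
- rewrite scaler_sumr -big_split; apply: eq_bigr => k _ /=.
  by rewrite add_lfunE scale_lfunE.
- by move=> n; rewrite geq_max => /andP[_ /hM].
- by move=> n; rewrite geq_max => /andP[/hN].
Qed.

Lemma pairing_dinj f k (x : G k) : pairing f (dinj x) = f k x.
Proof.
rewrite /pairing -/(@fsum K _ K^o _) (fsum_single (N := k)) ?dinjE // => i ik.
by rewrite /= dfwith_out ?linear0 //; apply/eqP => e; apply: ik.
Qed.

Lemma pairing_dinjl k (x : gdual G k) u : pairing (dinj x) u = x (u k).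
Proof.
rewrite /pairing -/(@fsum K _ K^o _) (fsum_single (N := k)) ?dinjE // => i ik.
by rewrite (dinj_homog _ ik) zero_lfunE.
Qed.

Lemma pairing_graded : graded_pairing (@pairing K G : _ -> _ -> K^o).
Proof.
split; [exact: pairing_linl|exact: pairing_linear|].
move=> d e f u hf hu de; rewrite /pairing -/(@fsum K _ K^o _).
rewrite (fsumE (r := [::])) ?big_nil // => n _.
have [nd|/eqP nd] := eqVneq n%:Z d.
  by rewrite hu ?linear0 // nd => nd'; apply: de; rewrite -nd'.
by rewrite hf ?zero_lfunE.
Qed.

(** Lets [G] act as the dual of its dual, so that operators with values in a contragredient also
    have a [form]. *)
Definition copairing u f : K^o := pairing f u.

Lemma copairing_graded : graded_pairing copairing.
Proof.
split; [exact: pairing_linear|exact: pairing_linl|].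
by move=> d e u f hu hf de; apply: (gpair_orth pairing_graded hf hu) => h; apply: de.
Qed.

Lemma pairing_sgn f u : pairing (sgn f) u = pairing f (sgn u).
Proof.
apply: eq_fsbigr => n _ /=; by rewrite scale_lfunE linearZ.
Qed.

Lemma pairing_injl f g : (forall u, pairing f u = pairing g u) -> f = g.
Proof. by move=> h; apply: dsumP => n; apply/lfunP => x; rewrite -!pairing_dinj h. Qed.

Lemma pairing_injr u : (forall p f, homogz p%:Z f -> pairing f u = 0) -> u = 0.
Proof.
move=> h; apply: dsumP => n; apply: vect_sep => phi.
by have := h n _ (dinj_homogz (phi : gdual G n)); rewrite pairing_dinjl.
Qed.

Lemma pairing_eq0 f : (forall p u, homogz p%:Z u -> pairing f u = 0) -> f = 0.
Proof.
move=> h; apply: dsumP => n; apply/lfunP => x; rewrite zero_lfunE -pairing_dinj.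
by apply: h; apply: dinj_homogz.
Qed.

Lemma homogz_pairing d f :
  (forall e u, homogz e u -> d <> e -> pairing f u = 0) -> homogz d f.
Proof.
move=> h n nd; apply/lfunP => x; rewrite -pairing_dinj zero_lfunE.
by apply: (h n%:Z); [exact: dinj_homogz|move=> e; apply: nd].
Qed.

End Pairing.

Section Adjoint.
Variables (K : numFieldType) (A B C : nat -> vectType K).
Variables (L : dsum A -> dsum A) (Y : dsum A -> dsum B -> fser (dsum C)).
Hypotheses (hL : shifts (-1) L) (hY : graded_product Y).

Lemma pairing_adjoint a f n b :
  pairing (adjoint L Y a f n) b = pairing f (conj_prod Y L 1 a b n).
Proof.
apply: adjointE.
- exact: shifts_linear hL.
- move=> k x /homogz_nat /(shifts_homogz hL) h; apply/homogz_nat.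
  by move: h; congr homogz; lia.
- by move=> x /homogz_nat /(shifts_homogz hL); apply: homogz_neg.
- exact: gp_linl.
- exact: gp_linr.
move=> p q k a' b' l /homogz_nat ha /homogz_nat hb.
by move=> h; apply: (gp_homogz hY ha hb).
Qed.

Lemma form_adjoint b a f : form (@copairing K B) (adjoint L Y) b a f
  = form (@pairing K C : _ -> _ -> K^o) Y f (expL 1 L (sgn a)) b.
Proof.
rewrite -(conj_prod_fsum (@pairing_graded K C) hY hL _ _ _ _).2.
by apply: eq_fsum => n; apply: pairing_adjoint.
Qed.

Lemma adjoint_graded : graded_product (adjoint L Y).
Proof.
split.
- move=> f n c a a'; apply: pairing_injl => b.
  rewrite (linD (pairing_linl b)) (linZ (pairing_linl b)) !pairing_adjoint.
  by rewrite (conj_prod_linl hY hL 1 b n) pairing_linear.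
- move=> a n c f g; apply: pairing_injl => b.
  rewrite (linD (pairing_linl b)) (linZ (pairing_linl b)) !pairing_adjoint.
  exact: pairing_linl.
move=> d e n a f ha hf; apply: homogz_pairing => k b hb kd.
rewrite pairing_adjoint.
have h := conj_prod_homogz hY hL 1 ha hb (n := n).
apply: (gpair_orth (@pairing_graded K C) hf h); lia.
Qed.

End Adjoint.

(** * The semidirect product and its restricted dual *)

Section ConformalVector.
Variables (K : numFieldType) (V : vertexData K).
Hypothesis hV : is_voa V.

Lemma conf_homogz : homogz 2 (conf V).
Proof. by apply/(homogz_nat 2); apply: v_conf_deg. Qed.

(** omega = L(-2)1 and [L(1), L(-2)] = 3 L(-1) without central term, while L(1) and L(-1) kill the
    vacuum. *)
Lemma vL1_conf : vL 1 (conf V) = 0.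
Proof.
have cr n (a : dsum V) : n <= 0 -> vY a (vac V) n = scst a n by exact: (v_creation hV).
have Lvac j : -1 <= j -> vL j (vac V) = 0.
  by move=> hj; rewrite /vL /vmode /Res cr /scst; [case: eqP => //; lia|lia].
have -> : conf V = vL (-2) (vac V) by rewrite /vL /vmode /Res cr.
have [c hc] := v_virasoro hV; have := hc 1 (-2) (vac V).
have vL0 j : vL j (0 : dsum V) = 0 by apply: (lin0 (v_linearr hV _ _)).
by rewrite (Lvac 1) // (Lvac (1 - 2)) // vL0 subr0 scaler0 add0r => ->; rewrite scale0r.
Qed.

Lemma mY_graded (W : moduleData V) : is_module W -> graded_product (@mY K V W).
Proof.
move=> hW; split; [exact: m_linearl|exact: m_linearr|].
move=> d e n a u /homogz_cases[->|[p -> ha]] hu.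
  by rewrite (lin0 (m_linearl hW u n)).
case: (homogz_cases hu) => [->|[q -> {}hu]].
  by rewrite (lin0 (m_linearr hW a n)).
by move=> k; apply: mY_deg.
Qed.

Lemma mL_shifts (W : moduleData V) j : graded_product (@mY K V W) ->
  shifts (- j) (@mL K V W j).
Proof.
move=> hW; split; first exact: (gp_linr hW).
move=> d u hu; have := gp_homogz hW conf_homogz hu (n := - (j + 1) - 1).
by congr homogz; lia.
Qed.

Lemma vY_graded : graded_product (@vY K V).
Proof. exact: mY_graded (adjoint_is_module hV). Qed.

Lemma vL1_shifts : shifts (-1) (@vL K V 1).
Proof. exact: (mL_shifts (W := adjoint_module V) 1 vY_graded). Qed.

Variable W : moduleData V.
Hypothesis hW : graded_product (@mY K V W).

Lemma contragredient_graded : graded_product (@mY K V (contragredient W)).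
Proof. exact: adjoint_graded vL1_shifts hW. Qed.

(** Since omega has degree 2 and L(1) omega = 0, the series e^{zL(1)} (-z^{-2})^{L(0)} omega is the
    monomial z^{-4} omega; inserted at z^{-1} it reverses the modes of omega. *)
Lemma mL_contragredient j (g : dsum (contragredient W)) (w : dsum W) :
  pairing (mL j g : dsum (gdual W)) w = pairing g (mL (- j) w).
Proof.
rewrite [LHS](pairing_adjoint vL1_shifts hW) /conj_prod.
have -> : sconj 1 (vL 1) (conf V) = fun n => if n == -4 then conf V else 0.
  apply/funext => n; rewrite /sconj /sexp -/(fsum _) (fsum_single (N := 0%N)).
    rewrite expr0 fact0 divr1 scale1r subr0 (szL0_homog _ conf_homogz).
    by rewrite sqrrN expr1n scale1r.
  move=> [|i] // _; rewrite (szL0_homog _ conf_homogz) iterSr.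
  case: eqP => _; rewrite ?sqrrN ?expr1n ?scale1r ?vL1_conf;
    rewrite ?(lin0 (shifts_linear vL1_shifts)).
    by rewrite (lin0 (linear_iter i (shifts_linear vL1_shifts))) scaler0.
  by rewrite (lin0 (linear_iter i (shifts_linear vL1_shifts))) scaler0.
rewrite /sbind -/(fsum _) (fsum_single (N := -4)) => [|i /eqP/negPf ->]; last first.
  exact: (lin0 (gp_linl hW _ _)).
by rewrite eqxx /sinv /mL /mmode /Res; congr (pairing g (mY _ _ _)); lia.
Qed.

End ConformalVector.

Section Pairs.
Variables (K : fieldType) (G H : nat -> vectType K).

Lemma dfst_linear : linear (@dfst K G H).
Proof. by move=> c x y; apply: dsumP. Qed.
Lemma dsnd_linear : linear (@dsnd K G H).
Proof. by move=> c x y; apply: dsumP. Qed.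
Lemma dfst_homogz d (x : dsum (gprod G H)) : homogz d x -> homogz d (dfst x).
Proof. by move=> h n nd; rewrite /= h. Qed.
Lemma dsnd_homogz d (x : dsum (gprod G H)) : homogz d x -> homogz d (dsnd x).
Proof. by move=> h n nd; rewrite /= h. Qed.
Lemma dpair_homogz d (x : dsum G) (y : dsum H) :
  homogz d x -> homogz d y -> homogz d (dpair x y).
Proof. by move=> hx hy n nd; rewrite /= hx ?hy. Qed.
Lemma dfst_pair (x : dsum G) (y : dsum H) : dfst (dpair x y) = x.
Proof. exact: dsumP. Qed.
Lemma dsnd_pair (x : dsum G) (y : dsum H) : dsnd (dpair x y) = y.
Proof. exact: dsumP. Qed.
Lemma dfst_sgn (x : dsum (gprod G H)) : dfst (sgn x) = sgn (dfst x).
Proof. exact: dsumP. Qed.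
Lemma dsnd_sgn (x : dsum (gprod G H)) : dsnd (sgn x) = sgn (dsnd x).
Proof. exact: dsumP. Qed.
Lemma dpair_linear (A : lmodType K) (f : A -> dsum G) (g : A -> dsum H) :
  linear f -> linear g -> linear (fun x => dpair (f x) (g x)).
Proof. by move=> lf lg c x y; apply: dsumP => n; rewrite lf lg. Qed.

End Pairs.

Lemma expL_morph (K : numFieldType) (G H : nat -> vectType K) (f : dsum G -> dsum H)
    (L : dsum G -> dsum G) (L' : dsum H -> dsum H) c x :
  linear f -> shifts (-1) L -> (forall x, f (L x) = L' (f x)) ->
  f (expL c L x) = expL c L' (f x).
Proof.
move=> lf hL e; rewrite /expL (fsum_lin lf (expL_supp hL c x)).
apply: eq_fsum => j; rewrite (linZ lf); congr (_ *: _).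
by elim: j => //= j <-.
Qed.

(** * Forms of the module operators and of the semidirect product *)

Section SemidirectForm.
Variables (K : numFieldType) (V : vertexData K) (W : moduleData V).
Hypotheses (hV : is_voa V) (hW : is_module W).

Let V' : moduleData V := contragredient (adjoint_module V).
Let W' : moduleData V := contragredient W.
Let U := semidirect W.

Let gV := vY_graded hV.
Let gW := mY_graded hV hW.
Let gV' : graded_product (@mY K V V') :=
  contragredient_graded hV (W := adjoint_module V) gV.
Let gW' : graded_product (@mY K V W') := contragredient_graded hV gW.
Let gWV : graded_product (@Y_WV_W K V W) := skewsym_graded gW (mL_shifts hV (-1) gW).
Let gW'V : graded_product (@Y_W'V_W' K V W) :=
  skewsym_graded gW' (mL_shifts hV (-1) gW').
Let gV'V : graded_product (@Y_V'V_V' K V) :=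
  skewsym_graded gV' (mL_shifts hV (-1) gV').
Let gWW' : graded_product (@Y_WW'_V' K V W) :=
  adjoint_graded (mL_shifts hV 1 gW) gWV.
Let gW'W : graded_product (@Y_W'W_V' K V W) :=
  skewsym_graded gWW' (mL_shifts hV (-1) gV').

Let EV : dsum V -> dsum V := expL 1 (vL 1).
Let EW : dsum W -> dsum W := expL 1 (@mL K V W 1).
Let EW' : dsum W' -> dsum W' := expL 1 (@mL K V W' 1).

Let BV (f : dsum V') (a b : dsum V) : K^o :=
  form (@pairing K V : _ -> _ -> K^o) (@vY K V) f a b.
Let BW (g : dsum W') (a : dsum V) (w : dsum W) : K^o :=
  form (@pairing K W : _ -> _ -> K^o) (@mY K V W) g a w.

Let form_V' a b f : form (@copairing K V) (@mY K V V') a b f = BV f (EV (sgn b)) a.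
Proof. exact: form_adjoint (vL1_shifts hV) gV a b f. Qed.

Let form_W' u a g : form (@copairing K W) (@mY K V W') u a g = BW g (EV (sgn a)) u.
Proof. exact: form_adjoint (vL1_shifts hV) gW u a g. Qed.

(** The adjoint of L(-1) on W is L(1) on W', hence [EW'] on the functional. *)
Let form_WV g u a : form (@pairing K W : _ -> _ -> K^o) (@Y_WV_W K V W) g u a
  = BW (sgn (EW' g)) (sgn a) (sgn u).
Proof.
apply: (form_skewsym gW (mL_shifts hV (-1) gW) (@pairing_graded K W)
  (mL_shifts hV 1 gW')) => [|f x]; first exact: pairing_sgn.
by rewrite (mL_contragredient hV gW).
Qed.

(** The roles are exchanged: the adjoint of L(-1) on W' is L(1) on W. The s put on [a] by
    skew-symmetry cancels the one from the contragredient. *)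
Let form_W'V u g a : form (@copairing K W) (@Y_W'V_W' K V W) u g a
  = BW (sgn g) (EV a) (sgn (EW u)).
Proof.
rewrite -[a in RHS]sgnK -form_W'.
apply: (form_skewsym gW' (mL_shifts hV (-1) gW') (@copairing_graded K W)
  (mL_shifts hV 1 gW)) => [f x|f x]; first by rewrite /copairing pairing_sgn.
by rewrite /copairing (mL_contragredient hV gW).
Qed.

Let form_V'V b f a : form (@copairing K V) (@Y_V'V_V' K V) b f a
  = BV (sgn f) (EV a) (sgn (EV b)).
Proof.
rewrite -[a in RHS]sgnK -form_V'.
apply: (form_skewsym gV' (mL_shifts hV (-1) gV') (@copairing_graded K V)
  (vL1_shifts hV)) => [f' x|f' x]; first by rewrite /copairing pairing_sgn.
by rewrite /copairing (mL_contragredient hV (W := adjoint_module V) gV).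
Qed.

Let form_WW' a u g : form (@copairing K V) (@Y_WW'_V' K V W) a u g
  = BW (sgn (EW' g)) (sgn a) (sgn (EW (sgn u))).
Proof. by rewrite -form_WV; apply: form_adjoint (mL_shifts hV 1 gW) gWV a u g. Qed.

Let form_W'W a g u : form (@copairing K V) (@Y_W'W_V' K V W) a g u
  = BW (sgn (EW' (sgn g))) (EV a) (sgn (EW u)).
Proof.
rewrite -[EV a]sgnK -[u in RHS]sgnK -form_WW'.
apply: (form_skewsym gWW' (mL_shifts hV (-1) gV') (@copairing_graded K V)
  (vL1_shifts hV)) => [f' x|f' x]; first by rewrite /copairing pairing_sgn.
by rewrite /copairing (mL_contragredient hV (W := adjoint_module V) gV).
Qed.

(* V' (+) W is the restricted dual of U, as W'' = W. *)
Definition pairingU (x : dsum (gprod V' W)) (y : dsum (gprod V W')) : K^o :=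
  pairing (dfst x : dsum (gdual V)) (dfst y) + pairing (dsnd y : dsum (gdual W)) (dsnd x).

Lemma pairingU_graded : graded_pairing pairingU.
Proof.
split=> [y|x|d e x y hx hy de].
- apply: linear_add; first exact: linear_comp (pairing_linl _) (@dfst_linear _ _ _).
  exact: linear_comp (@pairing_linear _ _ _) (@dsnd_linear _ _ _).
- apply: linear_add; first exact: linear_comp (@pairing_linear _ _ _) (@dfst_linear _ _ _).
  exact: linear_comp (pairing_linl _) (@dsnd_linear _ _ _).
rewrite /pairingU.
rewrite (gpair_orth (@pairing_graded K V) (dfst_homogz hx) (dfst_homogz hy) de).
rewrite add0r.
exact: (gpair_orth (@copairing_graded K W) (dsnd_homogz hx) (dsnd_homogz hy) de).
Qed.

Lemma pairingU_sgn x y : pairingU (sgn x) y = pairingU x (sgn y).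
Proof. by rewrite /pairingU !dfst_sgn !dsnd_sgn !pairing_sgn. Qed.

Lemma Y_semi_graded : graded_product (@Y_semi K V W).
Proof.
split=> [b n|a n|d e n a b ha hb].
- apply: dpair_linear; first exact: linear_comp (gp_linl gV _ n) (@dfst_linear _ _ _).
  apply: linear_add; first exact: linear_comp (gp_linl gW' _ n) (@dfst_linear _ _ _).
  exact: linear_comp (gp_linl gW'V _ n) (@dsnd_linear _ _ _).
- apply: dpair_linear; first exact: linear_comp (gp_linr gV _ n) (@dfst_linear _ _ _).
  apply: linear_add; first exact: linear_comp (gp_linr gW' _ n) (@dsnd_linear _ _ _).
  exact: linear_comp (gp_linr gW'V _ n) (@dfst_linear _ _ _).
apply: dpair_homogz.
  exact (gp_homogz gV (dfst_homogz ha) (dfst_homogz hb)).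
apply: homogzD; first exact (gp_homogz gW' (dfst_homogz ha) (dsnd_homogz hb)).
exact (gp_homogz gW'V (dsnd_homogz ha) (dfst_homogz hb)).
Qed.

Let LU : dsum (gprod V W') -> dsum (gprod V W') := @vL K U 1.

Lemma vLU_shifts : shifts (-1) LU.
Proof.
split; first exact: (gp_linr Y_semi_graded).
have hc : homogz 2 (conf U : dsum (gprod V W')).
  by apply: dpair_homogz => //; exact: conf_homogz.
by move=> d u hu; have := gp_homogz Y_semi_graded hc hu (n := - (1 + 1) - 1);
  congr homogz; lia.
Qed.

Lemma dfst_expU c x : dfst (expL c LU x) = expL c (vL 1) (dfst x).
Proof.
apply: (expL_morph _ _ (@dfst_linear _ _ _) vLU_shifts) => y.
by rewrite /LU /vL /vmode /Res /= /Y_semi !dfst_pair.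
Qed.

Lemma dsnd_expU c x : dsnd (expL c LU x) = expL c (@mL K V W' 1) (dsnd x).
Proof.
apply: (expL_morph _ _ (@dsnd_linear _ _ _) vLU_shifts) => y.
rewrite /LU /vL /vmode /Res /= /Y_semi !dsnd_pair dfst_pair.
by rewrite (lin0 (gp_linl gW'V _ _)) addr0.
Qed.

(** Three terms, as the product of two elements of W' is 0 in U. *)
Lemma form_U x y z : form pairingU (@Y_semi K V W) x y z =
  BV (dfst x) (dfst y) (dfst z) + (BW (dsnd z) (EV (sgn (dfst y))) (dsnd x)
   + BW (sgn (dsnd y)) (EV (dfst z)) (sgn (EW (dsnd x)))).
Proof.
rewrite -form_W' -form_W'V.
have s1 := gpair_form_supp (dfst x) (dfst y) (dfst z) (@pairing_graded K V) gV.
have s2 := gpair_form_supp (dsnd x) (dfst y) (dsnd z) (@copairing_graded K W) gW'.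
have s3 := gpair_form_supp (dsnd x) (dsnd y) (dfst z) (@copairing_graded K W) gW'V.
rewrite /BV /form -(fsumD s2 s3) -(fsumD s1 (fsuppD s2 s3)).
apply: eq_fsum => n; rewrite /pairingU /Y_semi dfst_pair dsnd_pair.
by rewrite (linD (pairing_linl _)).
Qed.

Variable T : dsum W -> dsum V.
Hypotheses (lT : linear T) (hT : level_preserving T).

Let Ts : dsum V' -> dsum W' := transpose T.

Let pairing_Ts f u : pairing (Ts f : dsum (gdual W)) u = pairing (f : dsum (gdual V)) (T u).
Proof. exact: transposeE. Qed.

Lemma T_homogz d u : homogz d u -> homogz d (T u).
Proof.
move=> /homogz_cases[->|[p -> hu]]; first by rewrite (lin0 lT).
exact/homogz_nat/hT.
Qed.

Lemma transpose_linear : linear Ts.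
Proof.
move=> c f g; apply: pairing_injl => u; rewrite pairing_Ts.
by rewrite !(linD (pairing_linl _)) !(linZ (pairing_linl _)) !pairing_Ts.
Qed.

Lemma transpose_homogz d f : homogz d f -> homogz d (Ts f).
Proof.
move=> hf; apply: homogz_pairing => e u hu de; rewrite pairing_Ts.
exact: (gpair_orth (@pairing_graded K V) hf (T_homogz hu) de).
Qed.

(* x in V' (+) W applied to the second leg of [skew_tensor T v]; on the first
   leg it gives the opposite. *)
Definition contraction (x : dsum (gprod V' W)) : dsum (gprod V W') :=
  dpair (T (dsnd x)) (- Ts (dfst x)).

Let R := contraction.

Lemma contraction_homogz d x : homogz d x -> homogz d (R x).
Proof.
move=> hx; apply: dpair_homogz; first exact/T_homogz/dsnd_homogz.
rewrite -scaleN1r; exact/homogzZ/transpose_homogz/dfst_homogz.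
Qed.

(** The middle sign is plus because its minus in the equation meets the minus from contracting a
    first leg of r; the last term has two such legs. The exponent is n = -m-1. *)
Definition voybe_coef (n : int) x y z : K^o :=
  pairingU x (Y_semi (R z) (R y) n)
  + pairingU y (conj_prod (@Y_semi K V W) LU 1 (R z) (R x) n)
  + pairingU z (op_prod (@Y_semi K V W) LU LU (R x) (R y) n).

Definition rb_defect n u v : dsum V :=
  vY (T u) (T v) n - (T (mY (T u) v n) + T (Y_WV_W u (T v) n)).
Definition strong_defect_a n u f : dsum W' :=
  mY (T u) (Ts f) n - Ts (mY (T u) f n) + Ts (Y_WW'_V' u (Ts f) n).
Definition strong_defect_b n u f : dsum W' :=
  Y_W'V_W' (Ts f) (T u) n - Ts (Y_V'V_V' f (T u) n) + Ts (Y_W'W_V' (Ts f) u n).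

(* The (V, W', W'), (W', V, W') and (W', W', V) parts of the Yang-Baxter
   expression are the Rota-Baxter identity, condition (a) and condition (b). *)
Definition rb_coef (n : int) (x y z : dsum (gprod V' W)) : K^o :=
  pairing (dfst x : dsum (gdual V)) (rb_defect n (dsnd z) (dsnd y))
  - pairing (strong_defect_a n (dsnd z) (dfst y) : dsum (gdual W)) (dsnd x)
  - pairing (strong_defect_b n (dsnd y) (dfst z) : dsum (gdual W)) (dsnd x).

Lemma fsum_voybe_coef x y z : fsum (fun n => voybe_coef n x y z) =
  form pairingU (@Y_semi K V W) x (R z) (R y)
  + form pairingU (@Y_semi K V W) y (expL 1 LU (sgn (R z))) (R x)
  + form pairingU (@Y_semi K V W) (sgn z) (expL 1 LU (R y)) (sgn (expL 1 LU (R x))).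
Proof.
have [s2 e2] := conj_prod_fsum pairingU_graded Y_semi_graded vLU_shifts y 1 (R z) (R x).
have [s3 e3] := op_prod_fsum pairingU_graded Y_semi_graded vLU_shifts vLU_shifts
  pairingU_sgn z (R x) (R y).
have s1 := gpair_form_supp x (R z) (R y) pairingU_graded Y_semi_graded.
by rewrite /voybe_coef (fsumD (fsuppD s1 s2) s3) (fsumD s1 s2) e2 e3.
Qed.

(** Every [T] or [Ts] applied outside a product is moved to the other side of the pairing, leaving
    only forms of the operators themselves. *)
Lemma fsum_rb_coef x y z : fsum (fun n => rb_coef n x y z) =
  form (@pairing K V : _ -> _ -> K^o) (@vY K V) (dfst x) (T (dsnd z)) (T (dsnd y))
  - form (@pairing K W : _ -> _ -> K^o) (@mY K V W) (Ts (dfst x)) (T (dsnd z)) (dsnd y)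
  - form (@pairing K W : _ -> _ -> K^o) (@Y_WV_W K V W) (Ts (dfst x)) (dsnd z) (T (dsnd y))
  - form (@copairing K W) (@mY K V W') (dsnd x) (T (dsnd z)) (Ts (dfst y))
  + form (@copairing K V) (@mY K V V') (T (dsnd x)) (T (dsnd z)) (dfst y)
  - form (@copairing K V) (@Y_WW'_V' K V W) (T (dsnd x)) (dsnd z) (Ts (dfst y))
  - form (@copairing K W) (@Y_W'V_W' K V W) (dsnd x) (Ts (dfst z)) (T (dsnd y))
  + form (@copairing K V) (@Y_V'V_V' K V) (T (dsnd x)) (dfst z) (T (dsnd y))
  - form (@copairing K V) (@Y_W'W_V' K V W) (T (dsnd x)) (Ts (dfst z)) (dsnd y).
Proof.
have s1 := gpair_form_supp (dfst x) (T (dsnd z)) (T (dsnd y)) (@pairing_graded K V) gV.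
have s2 := gpair_form_supp (Ts (dfst x)) (T (dsnd z)) (dsnd y) (@pairing_graded K W) gW.
have s3 := gpair_form_supp (Ts (dfst x)) (dsnd z) (T (dsnd y)) (@pairing_graded K W) gWV.
have s4 := gpair_form_supp (dsnd x) (T (dsnd z)) (Ts (dfst y)) (@copairing_graded K W) gW'.
have s5 := gpair_form_supp (T (dsnd x)) (T (dsnd z)) (dfst y) (@copairing_graded K V) gV'.
have s6 := gpair_form_supp (T (dsnd x)) (dsnd z) (Ts (dfst y)) (@copairing_graded K V) gWW'.
have s7 := gpair_form_supp (dsnd x) (Ts (dfst z)) (T (dsnd y)) (@copairing_graded K W) gW'V.
have s8 := gpair_form_supp (T (dsnd x)) (dfst z) (T (dsnd y)) (@copairing_graded K V) gV'V.
have s9 := gpair_form_supp (T (dsnd x)) (Ts (dfst z)) (dsnd y) (@copairing_graded K V) gW'W.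
(* The nine-term sum nests to the left, and each partial sum needs its own finite support before it
   is split. *)
have s12 := fsuppB s1 s2; have s13 := fsuppB s12 s3; have s14 := fsuppB s13 s4.
have s15 := fsuppD s14 s5; have s16 := fsuppB s15 s6; have s17 := fsuppB s16 s7.
have s18 := fsuppD s17 s8.
rewrite /form -(fsumB s1 s2) -(fsumB s12 s3) -(fsumB s13 s4) -(fsumD s14 s5).
rewrite -(fsumB s15 s6) -(fsumB s16 s7) -(fsumD s17 s8) -(fsumB s18 s9).
apply: eq_fsum => n.
rewrite /rb_coef /rb_defect /strong_defect_a /strong_defect_b /copairing.
rewrite (linB _ _ (@pairing_linear _ _ _)) (linD (@pairing_linear _ _ _)).
rewrite !(linD (pairing_linl _)) !(linN _ (pairing_linl _)) !pairing_Ts.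
by rewrite !opprD !opprK !addrA.
Qed.

(** By [form_U] the three forms on U yield, in order, the terms 1, 4, 7, then 2, 5, 9, then 3, 6, 8
    of [fsum_rb_coef]. *)
Lemma fsum_voybe_rb x y z :
  fsum (fun n => voybe_coef n x y z) = fsum (fun n => rb_coef n x y z).
Proof.
rewrite fsum_voybe_coef fsum_rb_coef !form_U form_V' form_W' form_WV form_W'V form_V'V.
rewrite form_WW' form_W'W -/(BV _ _ _) -/(BW _ _ _).
rewrite !dfst_sgn !dsnd_sgn !dfst_expU !dsnd_expU !dfst_sgn !dsnd_sgn.
rewrite /R /contraction !dfst_pair !dsnd_pair.
have EsE a : EV (sgn (EV a)) = sgn a by exact: expL_sgn_expL (vL1_shifts hV) a.
rewrite -/EV -/EW'.
(* Entries of V carry two exponentials when one comes from a primed product and one from the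
   contragredient action; E s E = s removes both. *)
rewrite !EsE sgnK.
have N1 f a w : BW (- f) a w = - BW f a w.
  exact: linN (form_linf (@pairing_graded K W) gW a w).
have sN (G : nat -> vectType K) (g : dsum G) : sgn (- g) = - sgn g.
  exact: linN (@sgn_linear _ _).
have EN g : EW' (- g) = - EW' g.
  exact: linN (expL_linear (mL_shifts hV 1 gW') 1).
rewrite !(sN, EN, N1).
ring.
Qed.

(** R preserves degrees, so the three products have degrees s + q + n, p - s - n and p - q - n, to
    be matched with p, q and s respectively: the same condition on n each time. *)
Lemma voybe_coef_homog p q s n x y z :
  homogz p x -> homogz q y -> homogz s z -> n <> p - q - s -> voybe_coef n x y z = 0.
Proof.
move=> hx hy hz ne; have hR := contraction_homogz; rewrite /voybe_coef.
have h1 := gp_homogz Y_semi_graded (hR _ _ hz) (hR _ _ hy) (n := n).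
have h2 := conj_prod_homogz Y_semi_graded vLU_shifts 1 (hR _ _ hz) (hR _ _ hx) (n := n).
have h3 :=
  op_prod_homogz Y_semi_graded vLU_shifts vLU_shifts (hR _ _ hx) (hR _ _ hy) (n := n).
rewrite (gpair_orth pairingU_graded hx h1) ?(gpair_orth pairingU_graded hy h2);
  rewrite ?(gpair_orth pairingU_graded hz h3) ?addr0 //; lia.
Qed.

Lemma rb_coef_homog p q s n x y z :
  homogz p x -> homogz q y -> homogz s z -> n <> p - q - s -> rb_coef n x y z = 0.
Proof.
move=> hx hy hz ne.
have hf1 := dfst_homogz hx; have hf2 := dfst_homogz hy; have hf3 := dfst_homogz hz.
have hu1 := dsnd_homogz hx; have hu2 := dsnd_homogz hy; have hu3 := dsnd_homogz hz.
have hA := T_homogz hu3; have hB := T_homogz hu2.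
have hg2 := transpose_homogz hf2; have hg3 := transpose_homogz hf3.
have h1 : homogz (s + q + n) (rb_defect n (dsnd z) (dsnd y)).
  apply: homogzB; first exact (gp_homogz gV hA hB).
  apply: homogzD; apply: T_homogz; first exact (gp_homogz gW hA hu2).
  exact (gp_homogz gWV hu3 hB).
have h2 : homogz (s + q + n) (strong_defect_a n (dsnd z) (dfst y)).
  apply: homogzD; [apply: homogzB|].
  - exact (gp_homogz gW' hA hg2).
  - exact (transpose_homogz (gp_homogz gV' hA hf2)).
  - exact (transpose_homogz (gp_homogz gWW' hu3 hg2)).
have h3 : homogz (s + q + n) (strong_defect_b n (dsnd y) (dfst z)).
  apply: homogzD; [apply: homogzB|].
  - exact (gp_homogz gW'V hg3 hB).
  - exact (transpose_homogz (gp_homogz gV'V hf3 hB)).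
  - exact (transpose_homogz (gp_homogz gW'W hg3 hu2)).
have ne' : p <> s + q + n by lia.
rewrite /rb_coef (gpair_orth (@pairing_graded K V) hf1 h1 ne').
have -> : pairing (strong_defect_a n (dsnd z) (dfst y) : dsum (gdual W)) (dsnd x) = 0.
  exact (gpair_orth (@copairing_graded K W) hu1 h2 ne').
have -> : pairing (strong_defect_b n (dsnd y) (dfst z) : dsum (gdual W)) (dsnd x) = 0.
  exact (gpair_orth (@copairing_graded K W) hu1 h3 ne').
by rewrite !subr0.
Qed.

(** Homogeneity upgrades the equality of the sums over n to an equality for each n. *)
Lemma voybe_coef_rb p q s n x y z : homogz p x -> homogz q y -> homogz s z ->
  voybe_coef n x y z = rb_coef n x y z.
Proof.
move=> hx hy hz.
apply: (@fsum_inj _ _ _ (p - q - s) (fun n => voybe_coef n x y z)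
  (fun n => rb_coef n x y z)).
- by move=> i; apply: voybe_coef_homog hx hy hz.
- by move=> i; apply: rb_coef_homog hx hy hz.
exact: fsum_voybe_rb.
Qed.

End SemidirectForm.

(** * Tensors and the Yang-Baxter expression *)

Section Tensors.
Variable K : fieldType.

Section Lift.
Variables A B E : vectType K.

Lemma tlift_linear (beta : A -> B -> E) : (forall a, linear (beta a)) ->
  linear (tlift beta).
Proof.
move=> hr c s t; rewrite /tlift scaler_sumr -big_split; apply: eq_bigr => i _.
by rewrite add_lfunE scale_lfunE hr.
Qed.

Lemma tlift_comp (F : vectType K) (lambda : E -> F) (beta : A -> B -> E) t :
  linear lambda -> lambda (tlift beta t) = tlift (fun a b => lambda (beta a b)) t.
Proof. by move=> ll; rewrite /tlift (lin_sum ll). Qed.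

Lemma eq_tlift (beta gamma : A -> B -> E) t :
  (forall a b, beta a b = gamma a b) -> tlift beta t = tlift gamma t.
Proof. by move=> e; apply: eq_bigr => i _. Qed.

End Lift.

Section Evaluation.
Variables A B C : vectType K.

Definition eval2 (phi : 'Hom(A, K^o)) (psi : 'Hom(B, K^o)) : 'Hom(tens A B, K^o) :=
  linfun (fun t : tens A B => psi (t phi) : K^o).

Lemma eval2E phi psi t : eval2 phi psi t = psi (t phi).
Proof.
rewrite /eval2 linfunE // => c s u.
by rewrite add_lfunE scale_lfunE linearP.
Qed.

Definition eval3 (phi : 'Hom(A, K^o)) (psi : 'Hom(B, K^o)) (chi : 'Hom(C, K^o))
  (X : tens3 A B C) : K^o := chi (X (eval2 phi psi)).

Lemma eval3_linear phi psi chi : linear (eval3 phi psi chi).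
Proof. by move=> c X Y; rewrite /eval3 add_lfunE scale_lfunE linearP. Qed.

Lemma eval3_pure3 phi psi chi a b c :
  eval3 phi psi chi (pure3 a b c) = phi a * psi b * chi c :> K.
Proof. by rewrite /eval3 pureE eval2E pureE !linearZ. Qed.

(** With e_i a basis of A, any functional F on A (x) B is the sum of the product functionals e_i^*
    (x) F(e_i (x) -), so testing on products suffices. *)
Lemma tens3_sep (X : tens3 A B C) :
  (forall phi psi chi, eval3 phi psi chi X = 0) -> X = 0.
Proof.
move=> h; apply/lfunP => F; rewrite zero_lfunE.
have -> : F = \sum_(i < \dim (fullv : {vspace A}))
    eval2 (dual_vec (vbasis fullv) i)
      (linfun (fun b => F (pure (vbasis fullv)`_i b) : K^o)).
  apply/lfunP => t; rewrite [in LHS](tens_decomp t) linear_sum sum_lfunE.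
  apply: eq_bigr => i _; rewrite eval2E linfunE // => c b b'.
  rewrite -linearP; congr (F _); apply/lfunP => f.
  by rewrite add_lfunE scale_lfunE !pureE linearP.
rewrite linear_sum big1 // => i _.
by apply: vect_sep => chi; apply: h.
Qed.

End Evaluation.
End Tensors.

Section DualBasis.
Variables (K : fieldType) (A : vectType K) (n : nat) (X : n.-tuple A).
Hypothesis hX : basis_of fullv X.

Lemma basis_decomp (a : A) : a = \sum_(i < n) (dual_vec X i a : K) *: tnth X i.
Proof.
rewrite {1}(coord_basis hX (memvf a)); apply: eq_bigr => i _.
by rewrite dual_vecE (tnth_nth 0).
Qed.

Lemma dual_basis_decomp (g : 'Hom(A, K^o)) :
  g = \sum_(i < n) (g (tnth X i) : K) *: dual_vec X i.
Proof.
apply/lfunP => a; rewrite {1}(basis_decomp a) linear_sum sum_lfunE.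
by apply: eq_bigr => i _; rewrite linearZ scale_lfunE; apply: mulrC.
Qed.

End DualBasis.

Section PairPieces.
Variables (K : fieldType) (G H : nat -> vectType K).

Definition inl_piece t (a : G t) : gprod G H t := (a, 0).
Definition inr_piece t (b : H t) : gprod G H t := (0, b).

Lemma inl_linear t : linear (@inl_piece t).
Proof. by move=> c x y; congr pair; rewrite /= scaler0 addr0. Qed.
Lemma inr_linear t : linear (@inr_piece t).
Proof. by move=> c x y; congr pair; rewrite /= scaler0 addr0. Qed.

Lemma dfst_dinj t (x : gprod G H t) : dfst (dinj x) = dinj x.1.
Proof.
apply: dsumP => n /=; have [->|nt] := eqVneq n t; first by rewrite !dfwith_in.
by rewrite !dfwith_out // eq_sym.
Qed.

Lemma dsnd_dinj t (x : gprod G H t) : dsnd (dinj x) = dinj x.2.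
Proof.
apply: dsumP => n /=; have [->|nt] := eqVneq n t; first by rewrite !dfwith_in.
by rewrite !dfwith_out // eq_sym.
Qed.

End PairPieces.

Section Reflexivity.
Variables (K : fieldType) (G H : nat -> vectType K).

Definition eval_pair t (x : gprod (gdual G) H t) : 'Hom(gprod G (gdual H) t, K^o) :=
  linfun (fun a : gprod G (gdual H) t => (x.1 a.1 + a.2 x.2 : K^o)).

Lemma eval_pairE t (x : gprod (gdual G) H t) a : eval_pair x a = x.1 a.1 + a.2 x.2 :> K.
Proof.
rewrite /eval_pair linfunE // => c b b' /=.
by rewrite linearP add_lfunE scale_lfunE scalerDr addrACA.
Qed.

(** Each piece is finite-dimensional, hence reflexive: the component in [H t] has as coordinates the
    values of [phi] on the dual basis. *)
Lemma eval_pair_surj t (phi : 'Hom(gprod G (gdual H) t, K^o)) :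
  exists x, phi = eval_pair x.
Proof.
pose e := vbasis (fullv : {vspace H t}).
pose f : gdual G t := linfun (fun a => phi ((a, 0) : gprod G (gdual H) t) : K^o).
pose u := \sum_(i < \dim (fullv : {vspace H t}))
  (phi ((0, dual_vec e i) : gprod G (gdual H) t) : K) *: e`_i.
exists ((f, u) : gprod (gdual G) H t); apply/lfunP => -[a g]; rewrite eval_pairE /=.
have -> : ((a, g) : gprod G (gdual H) t) = inl_piece _ a + inr_piece _ g.
  by congr pair; rewrite /= ?addr0 ?add0r.
rewrite linearD; congr (_ + _).
  rewrite /f linfunE //; exact: (linear_comp (linearP phi) (@inl_linear K G (gdual H) t)).
rewrite [in LHS](dual_basis_decomp (vbasisP fullv) g) (lin_sum (@inr_linear _ _ _ t)).
rewrite /u !linear_sum; apply: eq_bigr => i _.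
rewrite (linZ (@inr_linear _ _ _ t)) !linearZ -(tnth_nth 0); exact: mulrC.
Qed.

End Reflexivity.

(** * Contracting the legs of the skew tensor *)

Section Legs.
Variables (K : numFieldType) (V : vertexData K) (W : moduleData V).
Variables (T : dsum W -> dsum V) (d : nat -> nat).
Variable v : forall t, (d t).-tuple (W t).
Hypotheses (lT : linear T) (hT : level_preserving T).
Hypothesis hv : forall t, basis_of fullv (v t).

Let V' : moduleData V := contragredient (adjoint_module V).
Let W' : moduleData V := contragredient W.
Let U := semidirect W.
Let r : tensor2 U := skew_tensor T v.
Let R := contraction T.

Let ev t (x : gprod V' W t) : 'Hom(gprod V W' t, K^o) := eval_pair x.

Lemma pairingU_dinj t (x : gprod V' W t) y : pairingU (dinj x) y = ev x (y t).
Proof.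
rewrite eval_pairE /pairingU dfst_dinj dsnd_dinj pairing_dinj.
by rewrite pairing_dinjl.
Qed.

Lemma dinj_homogzK (G : nat -> vectType K) (t : nat) (x : dsum G) :
  homogz t%:Z x -> dinj (x t) = x.
Proof.
move=> hx; apply: dsumP => n; have [->|/eqP nt] := eqVneq n t; first exact: dinjE.
by rewrite (dinj_homog _ nt) hx // => -[].
Qed.

Let a_ t i : gprod V W' t := inl_piece _ (T (dinj (tnth (v t) i)) t).
Let b_ t i : gprod V W' t := inr_piece _ (dual_vec (v t) i : gdual W t).

Let ev_a t (x : gprod V' W t) i : ev x (a_ i) = x.1 (T (dinj (tnth (v t) i)) t).
Proof. by rewrite eval_pairE /= zero_lfunE addr0. Qed.

Let ev_b t (x : gprod V' W t) i : ev x (b_ i) = dual_vec (v t) i x.2.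
Proof. by rewrite eval_pairE /= linear0 add0r. Qed.

(** Expanding the W-part of x in the basis and T^* of its V'-part in the dual basis, the
    coefficients are the values of x on the second legs of r. *)
Lemma contraction_dinj t (x : gprod V' W t) :
  R (dinj x) t = \sum_(i < d t) ((ev x (b_ i) : K) *: a_ i - (ev x (a_ i) : K) *: b_ i).
Proof.
rewrite sumrB.
have -> : R (dinj x) t = inl_piece _ (T (dinj x.2) t)
    - inr_piece _ (transpose T (dinj x.1) t : gdual W t).
  by rewrite /R /contraction dfst_dinj dsnd_dinj; congr pair; rewrite /= ?subr0 ?sub0r.
congr (_ - _).
  rewrite [in LHS](basis_decomp (hv t) x.2).
  have l : linear (fun w : W t => inl_piece (gdual W) (T (dinj w) t)).
    by move=> c w w'; rewrite dinj_linear lT; apply: inl_linear.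
  by rewrite (lin_sum l); apply: eq_bigr => i _; rewrite (linZ l) ev_b.
rewrite [in LHS](dual_basis_decomp (hv t) (transpose T (dinj x.1) t)).
rewrite (lin_sum (@inr_linear _ _ _ t)); apply: eq_bigr => i _.
rewrite (linZ (@inr_linear _ _ _ t)) ev_a; congr (_ *: _).
by rewrite -pairing_dinj transposeE // pairing_dinjl.
Qed.

(** Replaces one copy of r by R: contraction of the second leg gives R and, r being skew,
    contraction of the first in [skew_tensor_legl] gives -R. *)
Lemma skew_tensor_legr t (E : vectType K) (h : gprod V W' t -> E) (y : gprod V' W t) :
  linear h ->
  tlift (fun a b => (ev y b : K) *: h a) (r t) = h (R (dinj y) t).
Proof.
move=> lh.
have l1 a : linear (fun b => (ev y b : K) *: h a).
  by move=> c b b'; rewrite linearP scalerDl scalerA.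
have l2 b : linear (fun a => (ev y b : K) *: h a).
  exact: linear_comp (@scale_lin _ _ _) lh.
rewrite contraction_dinj (lin_sum lh) [LHS](lin_sum (tlift_linear l1)).
apply: eq_bigr => i _; rewrite (linB _ _ (tlift_linear l1)) (linB _ _ lh) !(linZ lh).
by rewrite !tlift_pure.
Qed.

Lemma skew_tensor_legl t (E : vectType K) (h : gprod V W' t -> E) (y : gprod V' W t) :
  linear h ->
  tlift (fun a b => (ev y a : K) *: h b) (r t) = - h (R (dinj y) t).
Proof.
move=> lh.
have l1 a : linear (fun b => (ev y b : K) *: h a).
  by move=> c b b'; rewrite linearP scalerDl scalerA.
have l2 b : linear (fun a => (ev y b : K) *: h a).
  exact: linear_comp (@scale_lin _ _ _) lh.
rewrite contraction_dinj (lin_sum lh) [LHS](lin_sum (tlift_linear l2)) -sumrN.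
apply: eq_bigr => i _; rewrite (linB _ _ (tlift_linear l2)) (linB _ _ lh) !(linZ lh).
by rewrite !tlift_pure // opprB.
Qed.

Hypotheses (hV : is_voa V) (hW : is_module W).

Let ev_linear t p (x : gprod V' W p) (F : dsum (gprod V W') -> dsum (gprod V W')) :
  linear F -> linear (fun a : gprod V W' t => ev x (F (dinj a) p)).
Proof. by move=> lF c a b; rewrite dinj_linear lF linearP. Qed.

(** [T] and its transpose preserve degrees, so a single component of r determines all of R x. *)
Let R_dinjK t (x : gprod V' W t) : dinj (R (dinj x) t) = R (dinj x).
Proof. by apply: dinj_homogzK; apply: contraction_homogz => //; apply: dinj_homogz. Qed.

Let gU := Y_semi_graded hV hW.
Let sU := vLU_shifts hV hW.
Let L : dsum (gprod V W') -> dsum (gprod V W') := @vL K U 1.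

(** y and z both meet second legs, so no sign appears; [dot] reverses its arguments, which puts R z
    before R y. *)
Lemma eval_r12_r13 m p q s (x : gprod V' W p) (y : gprod V' W q) (z : gprod V' W s) :
  eval3 (ev x) (ev y) (ev z) (r12_r13 m r p q s)
  = pairingU (dinj x) (Y_semi (R (dinj z)) (R (dinj y)) (- m - 1)).
Proof.
have lP1 t (a' : dsum (gprod V W')) := @ev_linear t _ x _ (gp_linr gU a' (- m - 1)).
have lP2 t (a : dsum (gprod V W')) := @ev_linear t _ x _ (gp_linl gU a (- m - 1)).
rewrite pairingU_dinj -(R_dinjK y) -(skew_tensor_legr y (lP1 _ _)).
rewrite /r12_r13 (tlift_comp _ _ (eval3_linear _ _ _)); apply: eq_tlift => a b.
rewrite -(R_dinjK z).
rewrite -(skew_tensor_legr z (linear_comp (@scale_lin _ _ _) (lP2 _ _))).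
rewrite (tlift_comp _ _ (eval3_linear _ _ _)); apply: eq_tlift => a' b'.
rewrite eval3_pure3 [RHS]mulrC; congr (_ * _); exact: mulrC.
Qed.

(** x meets a first leg and z a second one, whence a single minus. *)
Lemma eval_r23_r12 m p q s (x : gprod V' W p) (y : gprod V' W q) (z : gprod V' W s) :
  eval3 (ev x) (ev y) (ev z) (r23_r12 m r p q s)
  = - pairingU (dinj y)
      (conj_prod (@Y_semi K V W) L 1 (R (dinj z)) (R (dinj x)) (- m - 1)).
Proof.
have lP1 t (a' : dsum (gprod V W')) :=
  @ev_linear t _ y _ (conj_prod_linr gU sU 1 a' (- m - 1)).
have lP2 t (a : dsum (gprod V W')) :=
  @ev_linear t _ y _ (conj_prod_linl gU sU 1 a (- m - 1)).
rewrite pairingU_dinj -(R_dinjK x) -(skew_tensor_legl x (lP1 _ _)).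
rewrite /r23_r12 (tlift_comp _ _ (eval3_linear _ _ _)); apply: eq_tlift => a b.
rewrite -(R_dinjK z).
rewrite -(skew_tensor_legr z (linear_comp (@scale_lin _ _ _) (lP2 _ _))).
rewrite (tlift_comp _ _ (eval3_linear _ _ _)); apply: eq_tlift => a' b'.
by rewrite eval3_pure3 [RHS]mulrC.
Qed.

Lemma eval_r13_r23 m p q s (x : gprod V' W p) (y : gprod V' W q) (z : gprod V' W s) :
  eval3 (ev x) (ev y) (ev z) (r13_r23 m r p q s)
  = pairingU (dinj z)
      (op_prod (@Y_semi K V W) L L (R (dinj x)) (R (dinj y)) (- m - 1)).
Proof.
have lP1 t (a' : dsum (gprod V W')) :=
  @ev_linear t _ z _ (op_prod_linl gU sU sU a' (- m - 1)).
have lP2 t (a : dsum (gprod V W')) :=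
  @ev_linear t _ z _ (op_prod_linr gU sU sU a (- m - 1)).
(* Here x and y both meet first legs; the double negation prepares the two signs from
   [skew_tensor_legl]. *)
rewrite pairingU_dinj -(R_dinjK x) -[RHS]opprK.
rewrite -(skew_tensor_legl x (linear_opp (lP1 _ _))).
rewrite /r13_r23 (tlift_comp _ _ (eval3_linear _ _ _)); apply: eq_tlift => a b.
rewrite -(R_dinjK y) scalerN.
rewrite -(skew_tensor_legl y (linear_comp (@scale_lin _ _ _) (lP2 _ _))).
rewrite (tlift_comp _ _ (eval3_linear _ _ _)); apply: eq_tlift => a' b'.
rewrite eval3_pure3 [_ * ev y _]mulrC; exact: esym (mulrA _ _ _).
Qed.

Lemma VOYBE_atP m : VOYBE_at m r <-> forall p q s (x : gprod V' W p)
  (y : gprod V' W q) (z : gprod V' W s),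
  voybe_coef T (- m - 1) (dinj x) (dinj y) (dinj z) = 0.
Proof.
have e p q s (x : gprod V' W p) (y : gprod V' W q) (z : gprod V' W s) :
    eval3 (ev x) (ev y) (ev z)
      (r12_r13 m r p q s - r23_r12 m r p q s + r13_r23 m r p q s)
    = voybe_coef T (- m - 1) (dinj x) (dinj y) (dinj z).
  rewrite (linD (eval3_linear _ _ _)) (linB _ _ (eval3_linear _ _ _)).
  by rewrite eval_r12_r13 eval_r23_r12 eval_r13_r23 opprK.
split=> [h p q s x y z|h p q s].
  by rewrite -e h (lin0 (eval3_linear _ _ _)).
apply: tens3_sep => phi psi chi.
have [x ->] := eval_pair_surj phi; have [y ->] := eval_pair_surj psi.
have [z ->] := eval_pair_surj chi.
by rewrite -/(ev x) -/(ev y) -/(ev z) e h.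
Qed.

Lemma bilinear_eq0 (A B : nat -> vectType K) (M : lmodType K)
    (F : dsum A -> dsum B -> M) :
  (forall b, linear (F^~ b)) -> (forall a, linear (F a)) ->
  (forall p q a b, homogz p%:Z a -> homogz q%:Z b -> F a b = 0) ->
  forall a b, F a b = 0.
Proof.
move=> ll lr h; apply: dsum_ind => [a a' ha ha' b|p a ha].
  by rewrite (linD (ll b)) ha ha' addr0.
apply: dsum_ind => [b b' hb hb'|q b hb]; last exact: h ha hb.
by rewrite (linD (lr a)) hb hb' addr0.
Qed.

Let Ts : dsum V' -> dsum W' := transpose T.
Let lTs : linear Ts := transpose_linear lT hT.

Let gV := vY_graded hV.
Let gW := mY_graded hV hW.
Let gV' : graded_product (@mY K V V') :=
  contragredient_graded hV (W := adjoint_module V) gV.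
Let gW' : graded_product (@mY K V W') := contragredient_graded hV gW.
Let gWV : graded_product (@Y_WV_W K V W) := skewsym_graded gW (mL_shifts hV (-1) gW).
Let gW'V : graded_product (@Y_W'V_W' K V W) :=
  skewsym_graded gW' (mL_shifts hV (-1) gW').
Let gV'V : graded_product (@Y_V'V_V' K V) :=
  skewsym_graded gV' (mL_shifts hV (-1) gV').
Let gWW' : graded_product (@Y_WW'_V' K V W) :=
  adjoint_graded (mL_shifts hV 1 gW) gWV.
Let gW'W : graded_product (@Y_W'W_V' K V W) :=
  skewsym_graded gWW' (mL_shifts hV (-1) gV').

Lemma rb_defect_linl n w : linear (fun u => rb_defect T n u w).
Proof.
apply: linear_add; first exact: linear_comp (gp_linl gV _ n) lT.
apply: linear_opp; apply: linear_add; apply: linear_comp lT _.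
  exact: linear_comp (gp_linl gW _ n) lT.
exact: (gp_linl gWV).
Qed.

Lemma rb_defect_linr n u : linear (fun w => rb_defect T n u w).
Proof.
apply: linear_add; first exact: linear_comp (gp_linr gV _ n) lT.
apply: linear_opp; apply: linear_add; apply: linear_comp lT _.
  exact: (gp_linr gW).
exact: linear_comp (gp_linr gWV _ n) lT.
Qed.

Lemma strong_defect_a_linl n f : linear (fun u => strong_defect_a T n u f).
Proof.
apply: linear_add; [apply: linear_add; [|apply: linear_opp]|].
- exact: linear_comp (gp_linl gW' _ n) lT.
- exact: linear_comp lTs (linear_comp (gp_linl gV' _ n) lT).
exact: linear_comp lTs (gp_linl gWW' _ n).
Qed.

Lemma strong_defect_a_linr n u : linear (fun f => strong_defect_a T n u f).
Proof.
apply: linear_add; [apply: linear_add; [|apply: linear_opp]|].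
- exact: linear_comp (gp_linr gW' _ n) lTs.
- exact: linear_comp lTs (gp_linr gV' _ n).
exact: linear_comp lTs (linear_comp (gp_linr gWW' _ n) lTs).
Qed.

Lemma strong_defect_b_linl n f : linear (fun u => strong_defect_b T n u f).
Proof.
apply: linear_add; [apply: linear_add; [|apply: linear_opp]|].
- exact: linear_comp (gp_linr gW'V _ n) lT.
- exact: linear_comp lTs (linear_comp (gp_linr gV'V _ n) lT).
exact: linear_comp lTs (gp_linr gW'W _ n).
Qed.

Lemma strong_defect_b_linr n u : linear (fun f => strong_defect_b T n u f).
Proof.
apply: linear_add; [apply: linear_add; [|apply: linear_opp]|].
- exact: linear_comp (gp_linl gW'V _ n) lTs.
- exact: linear_comp lTs (gp_linl gV'V _ n).
exact: linear_comp lTs (linear_comp (gp_linl gW'W _ n) lTs).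
Qed.

Lemma strong_relative_RB_atP m : strong_relative_RB_at T m <->
  [/\ forall u w, rb_defect T (- m - 1) u w = 0,
      forall u f, strong_defect_a T (- m - 1) u f = 0
    & forall u f, strong_defect_b T (- m - 1) u f = 0].
Proof.
split=> [[_ h1 h2 h3]|[h1 h2 h3]]; split=> //.
- by move=> u w; apply/eqP; rewrite subr_eq0; apply/eqP/h1.
- by move=> u w; apply/eqP; rewrite -subr_eq0; apply/eqP/h1.
Qed.

(** The three defects are isolated by vectors with one zero component: x in V' leaves the
    Rota-Baxter defect; for x in W, taking y in V' and z in W leaves (a), and y in W and z in V'
    leaves (b). *)
Lemma rb_coefP n :
  (forall p q s (x : gprod V' W p) (y : gprod V' W q) (z : gprod V' W s),
     rb_coef T n (dinj x) (dinj y) (dinj z) = 0) <->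
  [/\ forall u w, rb_defect T n u w = 0,
      forall u f, strong_defect_a T n u f = 0
    & forall u f, strong_defect_b T n u f = 0].
Proof.
split=> [h|[h1 h2 h3] p q s x y z]; last first.
  rewrite /rb_coef h1 h2 h3 (lin0 (@pairing_linear _ _ _)).
  by rewrite !(lin0 (pairing_linl _)) !subr0.
have {}h p q s (x y z : dsum (gprod V' W)) :
    homogz p%:Z x -> homogz q%:Z y -> homogz s%:Z z -> rb_coef T n x y z = 0.
  by move=> /dinj_homogzK <- /dinj_homogzK <- /dinj_homogzK <-.
split.
- apply: bilinear_eq0 => [w|u|p q u w hu hw]; first exact: rb_defect_linl.
    exact: rb_defect_linr.
  apply: pairing_injr => k f hf.
  have := h k q p (dpair f 0) (dpair 0 w) (dpair 0 u).
  rewrite /rb_coef !dfst_pair !dsnd_pair !(lin0 (@pairing_linear _ _ _)) !subr0.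
  by apply; apply: dpair_homogz.
- apply: bilinear_eq0 => [f|u|p q u f hu hf]; first exact: strong_defect_a_linl.
    exact: strong_defect_a_linr.
  apply: pairing_eq0 => k w hw; apply/eqP; rewrite -oppr_eq0; apply/eqP.
  have := h k q p (dpair 0 w) (dpair f 0) (dpair 0 u).
  rewrite /rb_coef !dfst_pair !dsnd_pair (lin0 (strong_defect_b_linr _ _)).
  rewrite !(lin0 (pairing_linl _)) subr0 sub0r.
  by apply; apply: dpair_homogz.
apply: bilinear_eq0 => [f|u|p q u f hu hf]; first exact: strong_defect_b_linl.
  exact: strong_defect_b_linr.
apply: pairing_eq0 => k w hw; apply/eqP; rewrite -oppr_eq0; apply/eqP.
have := h k p q (dpair 0 w) (dpair 0 u) (dpair f 0).
rewrite /rb_coef !dfst_pair !dsnd_pair (lin0 (strong_defect_a_linr _ _)).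
rewrite !(lin0 (pairing_linl _)) subr0 sub0r.
by apply; apply: dpair_homogz.
Qed.

Lemma VOYBE_at_strong_RB m : VOYBE_at m r <-> strong_relative_RB_at T m.
Proof.
rewrite VOYBE_atP strong_relative_RB_atP -rb_coefP.
split=> h p q s x y z; have := h p q s x y z;
  by rewrite (voybe_coef_rb hV hW lT hT _ (dinj_homogz x) (dinj_homogz y)
    (dinj_homogz z)).
Qed.

End Legs.

Section SkewSymmetricTensor.
Variables (K : fieldType) (V : vertexData K) (W : moduleData V).
Variables (T : dsum W -> dsum V) (d : nat -> nat).
Variable v : forall t, (d t).-tuple (W t).

Lemma flip_linear (A B : vectType K) : linear (@flip K A B).
Proof.
apply: tlift_linear => a c b b'; apply/lfunP => f.
by rewrite add_lfunE scale_lfunE !pureE linearP scalerDl scalerA.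
Qed.

Lemma flip_pure (A B : vectType K) (a : A) (b : B) : flip (pure a b) = pure b a.
Proof.
apply: tlift_pure => [b'|a'] c x y; apply/lfunP => f;
  rewrite add_lfunE scale_lfunE !pureE.
  by rewrite scalerDr !scalerA mulrC.
by rewrite linearP scalerDl scalerA.
Qed.

Lemma skew_tensorE t : skew_tensor T v t = T_tensor T v t - flip (T_tensor T v t).
Proof.
rewrite /skew_tensor sumrB; congr (_ - _).
by rewrite (lin_sum (@flip_linear _ _)); apply: eq_bigr => i _; rewrite flip_pure.
Qed.

Lemma skew_tensor_SD : in_SD (skew_tensor T v).
Proof.
move=> t; rewrite /skew_tensor (lin_sum (@flip_linear _ _)) -sumrN.
by apply: eq_bigr => i _; rewrite (linB _ _ (@flip_linear _ _)) !flip_pure opprB.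
Qed.

End SkewSymmetricTensor.

Theorem theorem3p5 (R : realType) (V : vertexData R[i]) (hV : is_voa V)
    (W : moduleData V) (hW : is_module W)
    (T : {linear dsum W -> dsum V}) (hT : level_preserving T)
    (d : nat -> nat) (v : forall t : nat, (d t).-tuple (W t))
    (hv : forall t : nat, basis_of fullv (v t)) :
  let r : tensor2 (semidirect W) := skew_tensor T v in
  [/\ (forall t : nat, r t = T_tensor T v t - flip (T_tensor T v t)),
      in_SD r,
      (forall m : int, VOYBE_at m r <-> strong_relative_RB_at T m)
    & (VOYBE_solution r <-> strong_relative_RB T)].
Proof.
have h m := VOYBE_at_strong_RB (linearP T) hT hv hV hW m.
split=> // [t||]; [exact: skew_tensorE|exact: skew_tensor_SD|].
split=> [[_ hr] ? m|hr]; first exact: (h m).1 (hr m).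
by split=> [|m]; [exact: skew_tensor_SD|exact: (h m).2 (hr m)].
Qed.
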